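(* Let $X$ be a real Banach space whose dual $X^*$ is isometrically isomorphic to $\ell_1$. For every $\varepsilon\in(0,r^*(X))$ there exists a closed subspace $Y$ of $X$ such that $Y$ is isometric to $W_\alpha$ with $\alpha=\left(\frac{r^*(X)}{1+\varepsilon},0,0,\dots\right)$, and $Y$ is $(1+\varepsilon)$-complemented in $X$.
   Context: All spaces are real. A closed subspace $Y\subseteq X$ is $\lambda$-complemented if there is a bounded linear projection $P$ of $X$ onto $Y$ with $\|P\|\le\lambda$. $B_Z$ is the closed unit ball of $Z$, $\operatorname{ext} K$ is the set of extreme points of a convex set $K$; for $A\subseteq X^*$, $A'$ denotes the set of $\sigma(X^*,X)$-cluster points (weak*-accumulation points) of the set $A$. $r^*(X):=\sup\{\|g^*\| : g^*\in(\operatorname{ext} B_{X^*})'\}$. Let $c$ be the space of convergent real sequences with the sup norm. For $\alpha\in B_{\ell_1}$, $W_\alpha$ is the closed subspace (with sup norm) $W_\alpha=\{x\in c:\ \lim_{i\to\infty}x(i)=\sum_{i=1}^\infty \alpha(i)x(i)\}$. *)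

(* Defs.v *)
From HB Require Import structures.
From mathcomp Require Import all_boot all_order all_algebra.
From mathcomp Require Import all_classical all_reals all_analysis.

Set Implicit Arguments.
Unset Strict Implicit.
Unset Printing Implicit Defensive.

Import Order.TTheory GRing.Theory Num.Theory.
Import numFieldNormedType.Exports.

Local Open Scope classical_set_scope.
Local Open Scope ring_scope.

Definition unit_ball (R : realType) (V : normedModType R) : set V :=
  [set x | `|x| <= 1].
Arguments unit_ball {R} V.

(* Meaningful for bounded f only: [sup] of an unbounded set is 0. *)
Definition op_norm (R : realType) (V W : normedModType R) (f : V -> W) : R :=
  sup [set `|f x| | x in unit_ball V].

Definition extreme_points (R : realType) (V : lmodType R) (K : set V) : set V :=
  [set x | K x /\ forall (y z : V) (t : R), K y -> K z -> 0 < t < 1 ->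
     x = t *: y + (1 - t) *: z -> y = x /\ z = x].

(* Linear isometry of the subspace A onto the subspace B; only the values of T
   on A matter. *)
Definition isometric_onto (R : realType) (V W : normedModType R)
    (A : set V) (B : set W) : Prop :=
  exists T : V -> W,
    [/\ forall (a : R) (x y : V), A x -> A y -> T (a *: x + y) = a *: T x + T y,
        forall x : V, A x -> `|T x| = `|x| &
        T @` A = B].

Definition closed_subspace (R : realType) (V : normedModType R) (Y : set V) :
    Prop :=
  [/\ closed Y, Y 0 &
      forall (a : R) (x y : V), Y x -> Y y -> Y (a *: x + y)].

Definition complemented (R : realType) (V : normedModType R) (lambda : R)
    (Y : set V) : Prop :=
  exists P : {linear V -> V},
    [/\ continuous P, range P = Y, forall y : V, Y y -> P y = y &
        op_norm P <= lambda].

Section op_norm_theory.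
Context {R : realType} {V W : normedModType R}.
Implicit Type f : V -> W.

Lemma op_norm_nonempty f : [set `|f x| | x in unit_ball V] !=set0.
Proof. by exists `|f 0|; exists 0 => //; rewrite /unit_ball /= normr0. Qed.

Lemma op_norm_has_sup (f : {linear V -> W}) : continuous f ->
  has_sup [set `|f x| | x in unit_ball V].
Proof.
move=> cf; split; first exact: op_norm_nonempty.
have /linear_boundedP : bounded_near f (nbhs (0 : V)).
  by apply: continuous_linear_bounded; exact: cf.
move=> /pinfty_ex_gt0 [r r0 fr]; exists r => _ [x /= x1 <-].
by rewrite (le_trans (fr x))// ler_piMr// ltW.
Qed.

Lemma le_op_norm (f : {linear V -> W}) (x : V) : continuous f ->
  `|f x| <= op_norm f * `|x|.
Proof.
move=> cf; have [->|x0] := eqVneq x 0; first by rewrite linear0 !normr0 mulr0.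
have nx : 0 < `|x| by rewrite normr_gt0.
rewrite -ler_pdivrMr//.
have -> : `|f x| / `|x| = `|f (`|x|^-1 *: x)|.
  by rewrite linearZ/= normrZ ger0_norm ?invr_ge0// mulrC.
apply: (sup_upper_bound (op_norm_has_sup cf)); exists (`|x|^-1 *: x) => //=.
by rewrite /unit_ball /= normrZ ger0_norm ?invr_ge0// mulVf// gt_eqF.
Qed.

Lemma op_norm_le f (r : R) : (forall x, `|x| <= 1 -> `|f x| <= r) ->
  op_norm f <= r.
Proof.
move=> fr; apply: ge_sup; first exact: op_norm_nonempty.
by move=> _ [x /= x1 <-]; exact: fr.
Qed.

End op_norm_theory.

Section dual.
Context {R : realType} {X : normedModType R}.

Definition dual_pred : {pred (X -> R^o)} :=
  fun f => `[< linear f /\ continuous f >].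

Lemma dual_predP (f : X -> R^o) :
  reflect (linear f /\ continuous f) (f \in dual_pred).
Proof. exact: asboolP. Qed.

Lemma dual_submod_closed : submod_closed dual_pred.
Proof.
split.
  apply/dual_predP; split; last exact: cst_continuous.
  by move=> a x y; rewrite -[RHS]/(a *: (0 : R^o) + 0) scaler0 addr0.
move=> a f g /dual_predP[lf cf] /dual_predP[lg cg]; apply/dual_predP; split.
  move=> b x y; rewrite -[LHS]/(a *: f _ + g _).
  rewrite -[RHS]/(b *: (a *: f x + g x) + (a *: f y + g y)).
  by rewrite lf lg !scalerDr !scalerA (mulrC a b) addrACA.
move=> x; apply: (@continuousD R R^o X (a \*: f) g); last exact: cg.
by apply: continuousZr; exact: cf.
Qed.

HB.instance Definition _ :=
  GRing.isSubmodClosed.Build R (X -> R^o) dual_pred dual_submod_closed.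

End dual.

Record dual (R : realType) (X : normedModType R) := Dual {
  dual_fun :> X -> R^o;
  dual_funP : dual_fun \in dual_pred }.

Section dual_normed.
Context {R : realType} {X : normedModType R}.

HB.instance Definition _ := [isSub for @dual_fun R X].
HB.instance Definition _ := [Choice of dual X by <:].
HB.instance Definition _ := [SubChoice_isSubLmodule of dual X by <:].

Lemma dual_linear (f : dual X) : linear f.
Proof. by case: (dual_predP _ (dual_funP f)). Qed.

Lemma dual_continuous (f : dual X) : continuous f.
Proof. by case: (dual_predP _ (dual_funP f)). Qed.

HB.instance Definition _ (f : dual X) :=
  GRing.isLinear.Build R X R^o *:%R (dual_fun f) (dual_linear f).

Let norm (f : dual X) : R := op_norm f.

Let ler_normD (f g : dual X) : norm (f + g) <= norm f + norm g.
Proof.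
apply: op_norm_le => x x1; rewrite (le_trans (ler_normD _ _))//.
by apply: lerD; apply: (sup_upper_bound (op_norm_has_sup _));
  [exact: dual_continuous|exists x|exact: dual_continuous|exists x].
Qed.

Let normr0_eq0 (f : dual X) : norm f = 0 -> f = 0.
Proof.
move=> f0; apply/val_inj/funext => x.
have := @le_op_norm _ _ _ f x (@dual_continuous f).
by rewrite -/(norm f) f0 mul0r normr_le0 => /eqP.
Qed.

Let normrZ_le (a : R) (f : dual X) : norm (a *: f) <= `|a| * norm f.
Proof.
apply: op_norm_le => x x1.
rewrite (_ : (a *: f) x = a *: f x)// normrZ ler_wpM2l//.
apply: (sup_upper_bound (op_norm_has_sup _)); first exact: dual_continuous.
by exists x.
Qed.

Let normrZ (a : R) (f : dual X) : norm (a *: f) = `|a| * norm f.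
Proof.
apply/eqP; rewrite eq_le normrZ_le/=.
have [->|a0] := eqVneq a 0.
  rewrite normr0 mul0r; apply: (sup_upper_bound (op_norm_has_sup _)).
    exact: dual_continuous.
  by exists 0; [rewrite /unit_ball /= normr0|rewrite linear0 normr0].
have na : 0 < `|a| by rewrite normr_gt0.
rewrite -ler_pdivlMl// -normfV.
by rewrite -{1}[f](scalerK a0) normrZ_le.
Qed.

HB.instance Definition _ := Lmodule_isNormed.Build R (dual X)
  ler_normD normrZ normr0_eq0.

Lemma dual_normE (f : dual X) : `|f| = op_norm f.
Proof. by []. Qed.

End dual_normed.

(* The dual with the weak* topology, i.e. the initial topology of its inclusion
   into the functions on X with pointwise convergence. *)
Definition weak_star (R : realType) (X : normedModType R) : Type :=
  initial_topology (fun f : dual X => (dual_fun f : {ptws X -> R^o})).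

HB.instance Definition _ (R : realType) (X : normedModType R) :=
  Topological.on (weak_star X).

Lemma weak_star_cvgP (R : realType) (X : normedModType R)
    (F : set_system (weak_star X)) (f : weak_star X) : Filter F ->
  F --> f <-> forall x : X, (fun g : dual X => g x) @ F --> (f : dual X) x.
Proof.
move=> FF; split=> [Ff x|Ff].
  have c : {ptws, (@dual_fun R X) @ F --> dual_fun f}.
    apply: (cvg_trans (cvg_app (@dual_fun R X) Ff)).
    exact: (@initial_continuous _ {ptws X -> R^o} (@dual_fun R X) f).
  exact: (pointwise_cvgP _ _).1 c x.
have c : {ptws, (@dual_fun R X) @ F --> dual_fun f} by apply/pointwise_cvgP.
move=> A; rewrite nbhsE => -[B [[C oC CB] Bf] BA].
apply: filterS BA _; rewrite -CB.
apply: c; apply: open_nbhs_nbhs; split => //. by move: Bf; rewrite -CB.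
Qed.

Definition weak_star_limit_points (R : realType) (X : normedModType R)
    (A : set (dual X)) : set (dual X) :=
  limit_point (A : set (weak_star X)).

Definition r_star (R : realType) (X : normedModType R) : R :=
  sup [set `|g| | g in
    weak_star_limit_points (extreme_points (unit_ball (dual X)))].

Section ell1.
Context {R : realType}.

Definition ell1_pred : {pred (nat -> R^o)} :=
  fun u => `[< cvgn [normed series u] >].

Lemma ell1_predP (u : nat -> R^o) :
  reflect (cvgn [normed series u]) (u \in ell1_pred).
Proof. exact: asboolP. Qed.

Lemma ell1_submod_closed : submod_closed ell1_pred.
Proof.
split.
  apply/ell1_predP; rewrite (_ : [normed series _] = cst 0); last first.
    by apply/funext => n /=; rewrite /series/= big1// => i _; rewrite normr0.
  exact: is_cvg_cst.
move=> a u v /ell1_predP cu /ell1_predP cv; apply/ell1_predP.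
apply: (@series_le_cvg R _ (fun n => `|a| *: `|u n| + `|v n|)) => [n|n|n|].
- exact: normr_ge0.
- by rewrite addr_ge0// mulr_ge0.
- rewrite -[X in X <= _]/(`|a *: u n + v n|).
  by rewrite (le_trans (ler_normD _ _))// normrZ.
- apply: (@is_cvg_seriesD R (`|a| *: (fun n => `|u n| : R))) => //.
  exact: is_cvg_seriesZ.
Qed.

HB.instance Definition _ :=
  GRing.isSubmodClosed.Build R (nat -> R^o) ell1_pred ell1_submod_closed.

End ell1.

Record ell1 (R : realType) := Ell1 {
  ell1_seq :> nat -> R^o;
  ell1_seqP : ell1_seq \in ell1_pred }.

Section ell1_normed.
Context {R : realType}.

HB.instance Definition _ := [isSub for @ell1_seq R].
HB.instance Definition _ := [Choice of ell1 R by <:].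
HB.instance Definition _ := [SubChoice_isSubLmodule of ell1 R by <:].

Lemma ell1_cvg (u : ell1 R) : cvgn [normed series u].
Proof. exact/ell1_predP/ell1_seqP. Qed.
Arguments ell1_cvg : clear implicits.

Let norm (u : ell1 R) : R := limn [normed series u].

Let ler_normD (u v : ell1 R) : norm (u + v) <= norm u + norm v.
Proof.
pose nu n : R := `|u n|; pose nv n : R := `|v n|.
have cu : cvgn (series nu) := ell1_cvg u.
have cv : cvgn (series nv) := ell1_cvg v.
rewrite -[X in _ <= X]/(limn (series nu) + limn (series nv)) -lim_seriesD//.
apply: lim_series_le; [exact: (ell1_cvg (u + v))|exact: is_cvg_seriesD|].
by move=> n; exact: ler_normD.
Qed.

Let normrZ (a : R) (u : ell1 R) : norm (a *: u) = `|a| * norm u.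
Proof.
pose nu n : R := `|u n|; have cu : cvgn (series nu) := ell1_cvg u.
rewrite -[RHS]/(`|a| *: limn (series nu)) -lim_seriesZ//.
by congr (limn (series _)); apply/funext => n; exact: normrZ.
Qed.

Let normr0_eq0 (u : ell1 R) : norm u = 0 -> u = 0.
Proof.
move=> u0; apply/val_inj/funext => n.
pose nu n : R := `|u n|; have cu : cvgn (series nu) := ell1_cvg u.
have ndu : nondecreasing_seq (series nu).
  by apply: nondecreasing_series => i _ _; exact: normr_ge0.
have := nondecreasing_cvgn_le ndu cu n.+1.
rewrite -[X in _ <= X]/(norm u) u0 seriesSr => un.
apply/eqP; rewrite -normr_le0; apply: le_trans un.
by rewrite lerDr /series/= sumr_ge0// => i _; exact: normr_ge0.
Qed.

HB.instance Definition _ := Lmodule_isNormed.Build R (ell1 R)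
  ler_normD normrZ normr0_eq0.

Lemma ell1_normE (u : ell1 R) : `|u| = limn [normed series u].
Proof. by []. Qed.

Lemma ell1_head_subproof (a : R) :
  (fun n => if n == 0%N then a else 0) \in @ell1_pred R.
Proof.
apply/ell1_predP; apply/cvg_ex; exists `|a|.
rewrite -(cvg_shiftn 1); apply: cvg_near_cst; near=> n.
rewrite /= addn1 -[LHS]/(\sum_(0 <= i < n.+1) `|if i == 0%N then a else 0|).
by rewrite big_nat_recl//= big1 ?addr0// => i _; rewrite normr0.
Unshelve. all: by end_near. Qed.

Definition ell1_head (a : R) : ell1 R := Ell1 (ell1_head_subproof a).

End ell1_normed.

Section cseq.
Context {R : realType}.

Definition cseq_pred : {pred (nat -> R^o)} := fun x => `[< cvgn x >].

Lemma cseq_predP (x : nat -> R^o) : reflect (cvgn x) (x \in cseq_pred).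
Proof. exact: asboolP. Qed.

Lemma cseq_submod_closed : submod_closed cseq_pred.
Proof.
split; first by apply/cseq_predP; exact: is_cvg_cst.
move=> a x y /cseq_predP cx /cseq_predP cy; apply/cseq_predP.
by apply: is_cvgD => //; apply: is_cvgZl_tmp => //; exact: is_cvg_cst.
Qed.

HB.instance Definition _ :=
  GRing.isSubmodClosed.Build R (nat -> R^o) cseq_pred cseq_submod_closed.

End cseq.

Record cseq (R : realType) := CSeq {
  cseq_seq :> nat -> R^o;
  cseq_seqP : cseq_seq \in cseq_pred }.

Section cseq_normed.
Context {R : realType}.

HB.instance Definition _ := [isSub for @cseq_seq R].
HB.instance Definition _ := [Choice of cseq R by <:].
HB.instance Definition _ := [SubChoice_isSubLmodule of cseq R by <:].

Lemma cseq_cvg (x : cseq R) : cvgn x.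
Proof. exact/cseq_predP/cseq_seqP. Qed.
Arguments cseq_cvg : clear implicits.

Let norm (x : cseq R) : R := sup (range (fun n => `|x n|)).

Lemma cseq_has_sup (x : cseq R) : has_sup (range (fun n => `|x n|)).
Proof.
split; first by exists `|x 0%N|, 0%N.
have /cvg_seq_bounded/pinfty_ex_gt0[M _ xM] := cseq_cvg x.
by exists M => _ [n _ <-]; exact: xM.
Qed.

Let le_norm (x : cseq R) n : `|x n| <= norm x.
Proof. by apply: (sup_upper_bound (cseq_has_sup x)); exists n. Qed.

Let norm_le (x : cseq R) r : (forall n, `|x n| <= r) -> norm x <= r.
Proof.
move=> xr; apply: ge_sup; first by case: (cseq_has_sup x).
by move=> _ [n _ <-].
Qed.

Let ler_normD (x y : cseq R) : norm (x + y) <= norm x + norm y.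
Proof.
by apply: norm_le => n; rewrite (le_trans (ler_normD _ _))// lerD// le_norm.
Qed.

Let normr0_eq0 (x : cseq R) : norm x = 0 -> x = 0.
Proof.
move=> x0; apply/val_inj/funext => n.
by apply/eqP; rewrite -normr_le0 -x0 le_norm.
Qed.

Let normrZ_le (a : R) (x : cseq R) : norm (a *: x) <= `|a| * norm x.
Proof.
apply: norm_le => n.
by rewrite (_ : (a *: x) n = a *: x n)// normrZ ler_wpM2l// le_norm.
Qed.

Let normrZ (a : R) (x : cseq R) : norm (a *: x) = `|a| * norm x.
Proof.
apply/eqP; rewrite eq_le normrZ_le/=.
have [->|a0] := eqVneq a 0.
  by rewrite normr0 mul0r (le_trans _ (le_norm _ 0%N)).
have na : 0 < `|a| by rewrite normr_gt0.
by rewrite -ler_pdivlMl// -normfV -{1}[x](scalerK a0) normrZ_le.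
Qed.

HB.instance Definition _ := Lmodule_isNormed.Build R (cseq R)
  ler_normD normrZ normr0_eq0.

Lemma cseq_normE (x : cseq R) : `|x| = sup (range (fun n => `|x n|)).
Proof. by []. Qed.

End cseq_normed.

(* Coordinates are numbered from 0. *)
Definition W_space (R : realType) (alpha : ell1 R) : set (cseq R) :=
  [set x | limn x = limn (series (fun i => alpha i * x i))].

(* Main.v *)
(* Identify X^* with l_1, with unit vectors e_n, and put r = r^*(X) and
   a = r / (1 + eps).  The extreme points of the dual ball are among the +-e_n,
   so some weak* cluster point g of them has a < |g| <= r.  As X is separable,
   suitable signed unit vectors phi_k = +-e_(n_k) converge weak* to g, and
   T x = (g x / a, phi_1 x, phi_2 x, ...) maps X into W_alpha with
   |T| <= 1 + eps.  If S : W_alpha -> X is a contraction with phi_k (S y) = y_k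
   for all k >= 0, then g (S y) = lim y = a y_0, so T S = id, S is isometric
   because the phi_k have norm 1, and S T is the required projection.

   S is the limit of operators S_K defined on the subspace F_K (a copy of
   l_oo^K) of the y in W_alpha with y_k = a y_0 for k >= K.  Given S_K meeting
   all the requirements up to an error d, the requirements for S_(K+1) are solved
   exactly, at distance O(d) from S_K, by an operator into the bidual l_oo: the
   coordinates e_(n_k) are prescribed by phi_k = y_k, all the other ones are
   shrunk a little and moved along a functional norming g, and |g| > a leaves
   room for correcting the value at g.  Local reflexivity brings this operator
   back into X at an arbitrarily small cost. *)
From HB Require Import structures.
Require Import Defs.
From mathcomp Require Import all_boot all_order all_algebra.
From mathcomp Require Import all_classical all_reals all_analysis.
From mathcomp Require Import lra ring.
Import Order.TTheory GRing.Theory Num.Theory.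
Import numFieldNormedType.Exports.
Local Open Scope classical_set_scope.
Local Open Scope ring_scope.

Set Implicit Arguments.
Unset Strict Implicit.
Unset Printing Implicit Defensive.

(** * The Hahn-Banach theorem *)

Section hahn_banach.
Context {R : realType} {V : lmodType R}.
Implicit Types (p q : V -> R).

Definition sublinear q :=
  (forall x y, q (x + y) <= q x + q y) /\
  (forall (c : R) x, 0 < c -> q (c *: x) <= c * q x).

Lemma sublinear_homo q c x : sublinear q -> 0 < c -> q (c *: x) = c * q x.
Proof.
move=> [_ qZ] c0; apply/eqP; rewrite eq_le qZ//=.
rewrite -ler_pdivlMl//; have c1 : 0 < c^-1 by rewrite invr_gt0.
by have := qZ _ (c *: x) c1; rewrite scalerA mulVf ?gt_eqF// scale1r.
Qed.

Lemma sublinear0 q : sublinear q -> q 0 = 0.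
Proof.
move=> sq; have := @sublinear_homo q 2 0 sq (ltr0Sn _ 1).
by rewrite scaler0; lra.
Qed.

Lemma sublinear_lb q x : sublinear q -> - q (- x) <= q x.
Proof.
move=> sq; have := sq.1 x (- x); rewrite subrr sublinear0//; lra.
Qed.

(* [shear q z] is the largest sublinear functional below [q] such that
   [shear q z (x + t z) = shear q z x + t (q z)] for [t >= 0]; shearing a minimal
   sublinear functional does not change it, which makes it additive. *)
Definition shear q z x := inf [set q (x + t *: z) - t * q z | t in [set t | 0 <= t]].

(** Writing [t z] as [(x + t z) - x] gives a lower bound independent of [t], so the infimum in
    [shear] is a genuine one. *)
Lemma shear_lb q z x t : sublinear q -> 0 <= t -> - q (- x) <= q (x + t *: z) - t * q z.
Proof.
move=> sq; rewrite le_eqVlt => /predU1P[<-|t0].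
  by rewrite scale0r addr0 mul0r subr0 sublinear_lb.
rewrite lerBrDr -(@sublinear_homo q)// addrC lerBlDr.
by rewrite (le_trans _ (sq.1 _ _))// addrAC subrr add0r.
Qed.

Lemma shear_has_inf q z x : sublinear q ->
  has_inf [set q (x + t *: z) - t * q z | t in [set t | 0 <= t]].
Proof.
move=> sq; split; first by exists (q (x + 0 *: z) - 0 * q z), 0 => //=.
by exists (- q (- x)) => _ [t /= t0 <-]; exact: shear_lb.
Qed.

Lemma shear_ub q z x t : sublinear q -> 0 <= t ->
  shear q z x <= q (x + t *: z) - t * q z.
Proof.
move=> sq t0; apply: ge_inf; last by exists t.
by case: (@shear_has_inf q z x sq).
Qed.

Lemma shear_le q z x : sublinear q -> shear q z x <= q x.
Proof.
by move=> sq; have := @shear_ub q z x 0 sq (lexx _); rewrite scale0r addr0 mul0r subr0.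
Qed.

Lemma shear_sublinear q z : sublinear q -> sublinear (shear q z).
Proof.
move=> sq; split=> [x y|c x c0].
  rewrite -lerBlDr; apply: lb_le_inf; first by case: (@shear_has_inf q z x sq).
  move=> _ [t /= t0 <-]; rewrite lerBlDr -lerBlDl.
  apply: lb_le_inf; first by case: (@shear_has_inf q z y sq).
  move=> _ [s /= s0 <-]; rewrite lerBlDl.
  have := @shear_ub q z (x + y) (t + s) sq (addr_ge0 t0 s0).
  rewrite scalerDl addrACA; have := sq.1 (x + t *: z) (y + s *: z).
  by lra.
rewrite -ler_pdivrMl//; apply: lb_le_inf; first by case: (@shear_has_inf q z x sq).
move=> _ [t /= t0 <-]; rewrite ler_pdivrMl//.
have := @shear_ub q z (c *: x) (c * t) sq (mulr_ge0 (ltW c0) t0).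
by rewrite -scalerA -scalerDr sublinear_homo// mulrBr mulrA.
Qed.

Lemma shear_opp q z : sublinear q -> shear q z (- z) <= - q z.
Proof.
move=> sq; have := @shear_ub q z (- z) 1 sq ler01.
by rewrite scale1r addNr sublinear0// mul1r sub0r.
Qed.

(** Zorn's lemma: a chain is bounded below by its pointwise infimum, which is finite because every
    member is at least [- p (- x)] at [x]. *)
Lemma minimal_sublinear p : sublinear p ->
  exists q, [/\ sublinear q, (forall x, q x <= p x) &
    forall r, sublinear r -> (forall x, r x <= q x) -> r = q].
Proof.
move=> sp; pose P (q : V -> R) := sublinear q /\ forall x, q x <= p x.
pose T := {q : V -> R | P q}.
(* The order is reversed, so that Zorn's maximal element is a minimal functional. *)
pose le (q r : T) := `[< forall x, sval r x <= sval q x >].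
have mkT q : sublinear q -> (forall x, q x <= p x) -> {t : T | sval t = q}.
  by move=> sq qp; exists (exist P q (conj sq qp)).
have [T0 _] := mkT _ sp (fun x => lexx (p x)).
have [|||A Atot|[q [sq qp]] qmin] := @Zorn T le.
- by move=> t; apply/asboolP.
- by move=> r s t /asboolP rs /asboolP st; apply/asboolP => x; exact: le_trans (st x) (rs x).
- move=> [s Ps] [t Pt] /asboolP /= st /asboolP /= ts.
  have e : s = t by apply/funext => x; apply/eqP; rewrite eq_le st ts.
  by subst t; congr exist; exact: Prop_irrelevance.
- have [[s0 As0]|/set0P/negP/negPn/eqP A0] := pselect (A !=set0); last first.
    by exists T0 => s; rewrite A0.
  pose I x := [set sval s x | s in A].
  have hI x : has_inf (I x).
    split; first by exists (sval s0 x), s0.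
    exists (- p (- x)) => _ [[s [ss sp']] As <-] /=.
    by rewrite (le_trans _ (sublinear_lb _ ss))// lerN2.
  have Iub x s : A s -> inf (I x) <= sval s x.
    by move=> As; apply: ge_inf; [case: (hI x)|exists s].
  have Ple x : inf (I x) <= p x.
    by apply: le_trans (Iub _ _ As0) _; case: (s0) => ? [].
  have Isub : sublinear (fun x => inf (I x)).
    split=> [x y|c x c0].
      rewrite -lerBlDr; apply: lb_le_inf; first by case: (hI x).
      move=> _ [s As <-]; rewrite lerBlDr -lerBlDl.
      apply: lb_le_inf; first by case: (hI y).
      move=> _ [t At <-]; rewrite lerBlDl.
      have [/asboolP st|/asboolP ts] := Atot _ _ As At.
        apply: le_trans (Iub _ _ At) _; apply: le_trans ((svalP t).1.1 _ _) _.
        by rewrite lerD2r st.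
      apply: le_trans (Iub _ _ As) _; apply: le_trans ((svalP s).1.1 _ _) _.
      by rewrite lerD2l ts.
    rewrite -ler_pdivrMl//; apply: lb_le_inf; first by case: (hI x).
    move=> _ [s As <-]; rewrite ler_pdivrMl//.
    by apply: le_trans (Iub _ _ As) _; exact: (svalP s).1.2.
  have [t tE] := mkT _ Isub Ple; exists t => s As; apply/asboolP => x /=; rewrite tE; exact: Iub.
- exists q; split => // r sr rq.
  have rp x : r x <= p x by exact: le_trans (rq x) (qp x).
  have [t tE] := mkT _ sr rp.
  rewrite -tE (qmin t)//; apply/asboolP => x /=; rewrite tE; exact: rq.
Qed.

(** Minimality is taken below [shear p z] instead of [p]: then
    [f (- z) <= shear p z (- z) <= - p z], which forces [f z = p z]. *)
Lemma hahn_banach_sublinear p z : sublinear p ->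
  exists f : V -> R, [/\ forall c x y, f (c *: x + y) = c * f x + f y,
    forall x, f x <= p x & f z = p z].
Proof.
move=> sp; have [q [sq qp qmin]] := minimal_sublinear (shear_sublinear z sp).
have qshear w : shear q w = q.
  by apply: qmin; [exact: shear_sublinear|move=> x; exact: shear_le].
have qle x : q x <= p x by exact: le_trans (qp x) (shear_le _ _ sp).
have qD x y : q (x + y) = q x + q y.
  apply/eqP; rewrite eq_le sq.1/=.
  have := @shear_ub q y x 1 sq ler01; rewrite qshear scale1r mul1r; lra.
have qN x : q (- x) = - q x.
  by have := qD x (- x); rewrite subrr sublinear0//; lra.
have qZ c x : q (c *: x) = c * q x.
  have [c0|c0|<-] := ltrgtP 0 c; last by rewrite scale0r mul0r sublinear0.
    exact: sublinear_homo.
  rewrite -[c]opprK scaleNr qN sublinear_homo ?oppr_gt0//; lra.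
exists q; split => //; first by move=> c x y; rewrite qD qZ.
apply/eqP; rewrite eq_le qle/=.
by rewrite -lerN2 -qN (le_trans (qp _))// shear_opp.
Qed.

Definition seminorm p :=
  (forall x y, p (x + y) <= p x + p y) /\ (forall (c : R) x, p (c *: x) <= `|c| * p x).

Lemma seminorm_ge0 p x : seminorm p -> 0 <= p x.
Proof.
move=> [pD pZ]; have := pD x (- x); rewrite subrr.
have := pZ 0 x; rewrite scale0r normr0 mul0r.
have := pZ (-1) x; rewrite scaleN1r normrN1 mul1r.
have := pZ 0 0; have := pD 0 0; rewrite addr0; lra.
Qed.

Lemma seminormN p x : seminorm p -> p (- x) <= p x.
Proof. by move=> [_ pZ]; have := pZ (-1) x; rewrite scaleN1r normrN1 mul1r. Qed.

(** The sublinear version is applied to the quotient seminorm, the infimum of [p (x - d)] over [D]: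
    it is at most 0 on [D] and at least [r] at [z]. *)
Lemma hahn_banach_dist p (D : set V) z r : seminorm p ->
  D 0 -> (forall c x y, D x -> D y -> D (c *: x + y)) ->
  (forall d, D d -> r <= p (z - d)) ->
  exists f : V -> R, [/\ forall c x y, f (c *: x + y) = c * f x + f y,
    forall x, `|f x| <= p x, forall d, D d -> f d = 0 & r <= f z].
Proof.
move=> np D0 DD rz; have [pD pZ] := np.
pose A x := [set p (x - d) | d in D]; pose q x := inf (A x).
have hA x : has_inf (A x).
  split; first by exists (p (x - 0)), 0.
  by exists 0 => _ [d Dd <-]; exact: seminorm_ge0.
have qub x d : D d -> q x <= p (x - d).
  by move=> Dd; apply: ge_inf; [case: (hA x)|exists d].
have sq : sublinear q.
  split=> [x y|c x c0].
    rewrite -lerBlDr; apply: lb_le_inf; first by case: (hA x).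
    move=> _ [d Dd <-]; rewrite lerBlDr -lerBlDl.
    apply: lb_le_inf; first by case: (hA y).
    move=> _ [e De <-]; rewrite lerBlDl.
    have Dde : D (d + e) by rewrite -[d]scale1r; exact: DD.
    by apply: le_trans (qub _ _ Dde) _; rewrite opprD addrACA.
  rewrite -ler_pdivrMl//; apply: lb_le_inf; first by case: (hA x).
  move=> _ [d Dd <-]; rewrite ler_pdivrMl//.
  have Dcd : D (c *: d) by rewrite -[c *: d]addr0; exact: DD.
  by rewrite (le_trans (qub _ _ Dcd))// -scalerBr (le_trans (pZ _ _))// gtr0_norm.
have [f [fl fq fz]] := hahn_banach_sublinear z sq.
have f0 : f 0 = 0 by have := fl 1 0 0; rewrite scale1r addr0; lra.
have fN x : f (- x) = - f x by have := fl (-1) x 0; rewrite scaleN1r addr0 f0; lra.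
have qp x : q x <= p x by rewrite -[X in p X]subr0 qub.
exists f; split => //.
- move=> x; rewrite ler_norml (le_trans (fq x) (qp x)) andbT lerNl -fN.
  by rewrite (le_trans (fq _))// (le_trans (qp _))// seminormN.
- move=> d Dd; have DN : D (- d) by rewrite -scaleN1r -[_ *: _]addr0; exact: DD.
  have p0 : p 0 = 0.
    by apply/eqP; rewrite eq_le seminorm_ge0// andbT; have := pZ 0 0; rewrite scale0r normr0 mul0r.
  have := fq d; have := fq (- d); have := qub d _ Dd; have := qub (- d) _ DN.
  by rewrite !subrr p0 fN; lra.
- by rewrite fz; apply: lb_le_inf; [case: (hA z)|move=> _ [d Dd <-]; exact: rz].
Qed.

End hahn_banach.

(** * Local reflexivity *)

Lemma scalar_sum {R : realType} {V : lmodType R} (f : V -> R) (I : Type) (r : seq I)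
    (a : I -> R) (x : I -> V) :
  (forall c x y, f (c *: x + y) = c * f x + f y) ->
  f (\sum_(i <- r) a i *: x i) = \sum_(i <- r) a i * f (x i).
Proof.
move=> fl; have f0 : f 0 = 0 by have := fl 1 0 0; rewrite scale1r addr0; lra.
by elim: r => [|i r IH]; rewrite ?big_nil// !big_cons fl IH.
Qed.

Section dual_lemmas.
Context {R : realType} {X : normedModType R}.
Implicit Types (f : dual X) (x : X).

Lemma dual_le f x : `|f x| <= `|f| * `|x|.
Proof. by rewrite dual_normE; apply: le_op_norm; exact: dual_continuous. Qed.

Lemma dual_norm_le f (C : R) : 0 <= C -> (forall x, `|f x| <= C * `|x|) -> `|f| <= C.
Proof.
move=> C0 fC; rewrite dual_normE; apply: op_norm_le => x x1.
by rewrite (le_trans (fC x))// ler_piMr.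
Qed.

Lemma dual_sumE (I : Type) (r : seq I) (f : I -> dual X) x :
  (\sum_(i <- r) f i : dual X) x = \sum_(i <- r) f i x.
Proof. by elim: r => [|i r IH]; rewrite ?big_nil// !big_cons -IH. Qed.

Lemma bounded_linear_continuous (Y : normedModType R) (f : {linear X -> Y}) (C : R) :
  (forall x, `|f x| <= C * `|x|) -> continuous f.
Proof.
move=> fC; apply/linear_bounded_continuous/linear_boundedP; near=> r => x.
by rewrite (le_trans (fC x))// ler_wpM2r//; near: r; exact: nbhs_pinfty_ge.
Unshelve. all: by end_near. Qed.

Lemma exists_dual (h : X -> R) (C : R) :
  (forall (c : R) x y, h (c *: x + y) = c * h x + h y) ->
  (forall x, `|h x| <= C * `|x|) -> exists f : dual X, forall x, f x = h x.
Proof.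
move=> hl hC; have lh : linear (h : X -> R^o) by move=> c x y; rewrite hl.
pose H := GRing.isLinear.Build R X R^o *:%R (h : X -> R^o) lh.
pose h' : {linear X -> R^o} := HB.pack (h : X -> R^o) H.
have ch : continuous h' by apply: (@bounded_linear_continuous _ h' C).
have hP : (h : X -> R^o) \in dual_pred by apply/dual_predP; split.
by exists (Dual hP).
Qed.

End dual_lemmas.

(* Principle of local reflexivity, in Helly's form: [beta] plays the part of a
   [K]-tuple of elements of the bidual solving all the constraints. *)
Lemma local_reflexivity {R : realType} {X : normedModType R} (I : finType) (K : nat)
    (c : I -> nat -> R) (z : I -> X) (p : I -> X -> R) (beta : nat -> dual X -> R)
    (eta : R) :
  (forall i, seminorm (p i)) ->
  (forall i, exists C, forall x, p i x <= C * `|x|) ->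
  (forall k (a : R) f g, beta k (a *: f + g) = a * beta k f + beta k g) ->
  (forall i (f : dual X) s, 0 <= s -> (forall x, `|f x| <= s * p i x) ->
     `|\sum_(k < K) c i k * beta k f - f (z i)| <= s) ->
  0 < eta ->
  exists x : nat -> X, forall i, p i (\sum_(k < K) c i k *: x k - z i) <= 1 + eta.
Proof.
move=> np bp bl hs eta0; apply: contrapT => /forallNP nx.
(* All constraints together form one constraint in the product [I -> X] with the maximum seminorm.
   If no [x] works, Hahn-Banach separates [z] from the range of [L]. *)
pose q (w : I -> X) : R := \big[Num.max/0]_i p i (w i).
have pq i w : p i (w i) <= q w by exact: le_bigmax.
have qle w b : 0 <= b -> (forall i, p i (w i) <= b) -> q w <= b.
  by move=> b0 wb; apply: bigmax_le.
have q0 w : 0 <= q w by exact: bigmax_ge_id.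
have nq : seminorm q.
  split=> [v w|a v].
    apply: qle => [|i]; first by rewrite addr_ge0.
    by rewrite (le_trans ((np i).1 _ _))// lerD.
  apply: qle => [|i]; first by rewrite mulr_ge0.
  by rewrite (le_trans ((np i).2 _ _))// ler_wpM2l.
pose L (x : nat -> X) : I -> X := fun i => \sum_(k < K) c i k *: x k.
have [|||f [fl fq fL fz]] := @hahn_banach_dist R (I -> X) q (range L) z (1 + eta) nq.
- by exists (fun=> 0) => //; apply/funext => i; rewrite /L big1// => k _; rewrite scaler0.
- move=> a _ _ [x _ <-] [y _ <-]; exists (fun k => a *: x k + y k) => //.
  apply/funext => i; rewrite /L -[RHS]/(a *: L x i + L y i) /L scaler_sumr -big_split/=.
  by apply: eq_bigr => k _; rewrite scalerDr !scalerA mulrC.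
- move=> _ [x _ <-]; have /existsNP[i /negP] := nx x; rewrite -ltNge => /ltW xi.
  apply: le_trans xi _; apply: le_trans (pq i _).
  by rewrite -[X in p i X]opprB seminormN.
pose sing i (x : X) : I -> X := fun j => if j == i then x else 0.
have singl i (a : R) x y : sing i (a *: x + y) = a *: sing i x + sing i y.
  apply/funext => j; rewrite -[RHS]/(a *: sing i x j + sing i y j) /sing.
  by case: ifP => // _; rewrite scaler0 addr0.
have qsing i x : q (sing i x) <= p i x.
  apply: qle => [|j]; first exact: seminorm_ge0.
  rewrite /sing; case: eqP => [->//|_].
  have := (np j).2 0 0; rewrite scale0r normr0 mul0r => /le_trans->//.
  exact: seminorm_ge0.
have /choice[psi psiE] : forall i, exists g : dual X, forall x, g x = f (sing i x).
  move=> i; have [C pC] := bp i; apply: (@exists_dual _ _ _ C) => [a x y|x].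
    by rewrite singl fl.
  by rewrite (le_trans (fq _))// (le_trans (qsing _ _)).
have fE w : f w = \sum_i psi i (w i).
  have -> : w = \sum_i 1 *: sing i (w i).
    apply/funext => j; rewrite fct_sumE (bigD1 j)//= big1 ?addr0 => [|i ij].
      by rewrite -[RHS]/(1 *: sing j (w j) j) scale1r /sing eqxx.
    by rewrite -[LHS]/(1 *: sing i (w i) j) scale1r /sing eq_sym (negPf ij).
  rewrite scalar_sum//; apply: eq_bigr => i _; rewrite mul1r psiE; congr (f (sing i _)).
  rewrite fct_sumE (bigD1 i)//= big1 ?addr0 => [|j ij].
    by rewrite -[RHS]/(1 *: sing i (w i) i) scale1r /sing eqxx.
  by rewrite -[LHS]/(1 *: sing j (w j) i) scale1r /sing eq_sym (negPf ij).
have fle i x : `|psi i x| <= p i x by rewrite psiE (le_trans (fq _)).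
pose A i : set R := [set (psi i x : R) | x in [set x | p i x <= 1]].
pose s i := sup (A i).
have p0 i : p i 0 = 0.
  apply/eqP; rewrite eq_le seminorm_ge0// andbT.
  by have := (np i).2 0 0; rewrite scale0r normr0 mul0r.
have hA i : has_sup (A i).
  split; first by exists (psi i 0), 0 => //=; rewrite p0.
  exists 1 => _ [x /= x1 <-]; exact: le_trans (ler_norm _) (le_trans (fle _ _) x1).
have s0 i : 0 <= s i.
  by apply: (sup_upper_bound (hA i)); exists 0; rewrite ?linear0//= p0.
have sP i x : `|psi i x| <= s i * p i x.
  have [px|px|px] := ltrgtP 0 (p i x); last by rewrite -px mulr0 px.
    rewrite -ler_pdivrMr//.
    have nrm y : p i y <= 1 -> psi i y <= s i.
      by move=> y1; apply: (sup_upper_bound (hA i)); exists y.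
    have e1 : p i ((p i x)^-1 *: x) <= 1.
      by rewrite (le_trans ((np i).2 _ _))// ger0_norm ?invr_ge0 ?(ltW px)// mulVf// gt_eqF.
    have := nrm _ e1; rewrite linearZ/= => h1.
    have := nrm _ (le_trans (seminormN _ (np i)) e1); rewrite linearN linearZ/= => h2.
    rewrite -[X in _ / X](gtr0_norm px) -normf_div mulrC ler_norml.
    by rewrite lerNl h2 h1.
  by have := seminorm_ge0 x (np i); rewrite leNgt px.
(* The dual of a maximum norm is the sum of the dual norms [s i]: vectors nearly norming the [psi i]
   are assembled into one point of the product, where [f] is at most 1. The slack [eta / 2] is
   shared among the indices. *)
have sum_s : \sum_i s i <= 1 + eta / 2.
  pose t := eta / 2 / (#|I|.+1)%:R.
  have t0 : 0 < t by rewrite !divr_gt0.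
  have /choice[x xP] : forall i, exists x, p i x <= 1 /\ s i - t < psi i x.
    move=> i; have [_ [x /= x1 <-] xs] := sup_adherent t0 (hA i).
    by exists x.
  have fx : f x <= 1.
    rewrite (le_trans (ler_norm _))// (le_trans (fq _))//.
    by apply: qle => // i; case: (xP i).
  have : \sum_i (s i - t) <= f x by rewrite fE; apply: ler_sum => i _; case: (xP i) => _ /ltW.
  rewrite sumrB sumr_const -mulr_natr.
  have : t * #|I|%:R <= eta / 2.
    rewrite /t -mulrA ler_piMr// ?divr_ge0 ?ltW// mulrC ltr_pdivrMr// mul1r.
    by rewrite ltr_nat.
  by lra.
(* Vanishing of [f] on the range of [L] becomes a relation between the [psi i]. Under [beta k] it
   turns the assumed bounds into [f z <= \sum_i s i], against [1 + eta <= f z]. *)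
have ck k : (k < K)%N -> \sum_i c i k *: psi i = 0.
  move=> kK; apply/val_inj/funext => x.
  rewrite -[LHS]/((\sum_i c i k *: psi i : dual X) x) dual_sumE.
  transitivity (f (L (fun j => if j == k then x else 0))); last by apply: fL; eexists.
  rewrite fE; apply: eq_bigr => i _; rewrite -[LHS]/(c i k * psi i x) /L.
  rewrite (bigD1 (Ordinal kK))//= eqxx big1 ?addr0 ?linearZ// => j jk.
  by rewrite -val_eqE/= in jk; rewrite (negPf jk) scaler0.
have : f z <= \sum_i s i.
  have : \sum_i \sum_(k < K) c i k * beta k (psi i) = 0.
    rewrite exchange_big/= big1// => k _; rewrite -scalar_sum// ck//.
    by have := bl k 1 0 0; rewrite scale1r addr0; lra.
  move=> e; rewrite fE -[leLHS]subr0 -[X in _ - X]e -sumrB; apply: ler_sum => i _.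
  by rewrite (le_trans _ (hs i (psi i) (s i) (s0 i) (sP i)))// distrC ler_norm.
by lra.
Qed.

Lemma dual_proportional {R : realType} {X : normedModType R} (f phi : dual X) :
  (forall x, phi x = 0 -> f x = 0) -> exists b, f = b *: phi.
Proof.
move=> f0; have [p0|/existsNP[x0 /eqP px0]] := pselect (forall x, phi x = 0).
  exists 0; apply/val_inj/funext => x; rewrite /= f0// -[RHS]/(0 * phi x) mul0r//.
exists (f x0 / phi x0); apply/val_inj/funext => x.
rewrite -[RHS]/(f x0 / phi x0 * phi x) -[LHS]/(f x).
have E (h : dual X) k : h (x - k *: x0) = h x - k * h x0 by rewrite linearB linearZ.
have := f0 (x - (phi x / phi x0) *: x0); rewrite !E divfK// subrr => /(_ erefl) /eqP.
by rewrite subr_eq0 => /eqP ->; rewrite mulrAC [RHS]mulrAC [phi x * _]mulrC.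
Qed.

(** Both kinds of constraints are seminorm constraints, with [|x| / r i] for the norms and
    [|phi j x| / e] for the scalar values. A functional dominated by a multiple of the latter is a
    multiple of [phi j], where [beta] is exact. *)
Lemma helly_mixed {R : realType} {X : normedModType R} (I J : finType) (K : nat)
    (c : I -> nat -> R) (z : I -> X) (r : I -> R)
    (a : J -> nat -> R) (phi : J -> dual X) (t : J -> R)
    (beta : nat -> dual X -> R) (eta : R) :
  (forall i, 0 < r i) ->
  (forall j, phi j != 0) ->
  (forall k (b : R) f g, beta k (b *: f + g) = b * beta k f + beta k g) ->
  (forall i (f : dual X), `|\sum_(k < K) c i k * beta k f - f (z i)| <= r i * `|f|) ->
  (forall j, \sum_(k < K) a j k * beta k (phi j) = t j) ->
  0 < eta ->
  exists x : nat -> X,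
    (forall i, `|\sum_(k < K) c i k *: x k - z i| <= r i * (1 + eta)) /\
    (forall j, `|phi j (\sum_(k < K) a j k *: x k) - t j| <= eta).
Proof.
move=> r0 phi0 bl hn hf eta0.
have betaZ k b f : beta k (b *: f) = b * beta k f.
  have b0 : beta k 0 = 0 by have := bl k 1 0 0; rewrite scale1r addr0; lra.
  by have := bl k b f 0; rewrite addr0 b0 addr0.
have /choice[w wP] : forall j, exists w, phi j w = t j.
  move=> j; have [p0|/existsNP[x0 /eqP px0]] := pselect (forall x, phi j x = 0).
    by case/eqP: (phi0 j); apply/val_inj/funext => x; exact: p0.
  by exists ((t j / phi j x0) *: x0); rewrite linearZ/= -[LHS]/(t j / phi j x0 * phi j x0) divfK.
(* Chosen so that [e * (1 + eta) = eta]. *)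
pose e := eta / (1 + eta).
have e0 : 0 < e by rewrite divr_gt0// addr_gt0.
pose p (i : I + J) (x : X) : R :=
  match i with inl i => `|x| / r i | inr j => `|phi j x| / e end.
pose c' (i : I + J) := match i with inl i => c i | inr j => a j end.
pose z' (i : I + J) := match i with inl i => z i | inr j => w j end.
have [|||x xP] := @local_reflexivity R X (I + J)%type K c' z' p beta eta _ _ bl _ eta0.
- move=> [i|j]; split => [x y|b x] /=.
  + by rewrite -mulrDl ler_wpM2r ?invr_ge0 ?(ltW (r0 i))// ler_normD.
  + by rewrite normrZ mulrA.
  + by rewrite -mulrDl ler_wpM2r ?invr_ge0 ?(ltW e0)// linearD ler_normD.
  + by rewrite linearZ normrZ mulrA.
- move=> [i|j] /=; first by exists (r i)^-1 => x; rewrite mulrC.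
  exists (`|phi j| / e) => x; rewrite mulrAC ler_wpM2r ?invr_ge0 ?(ltW e0)//; exact: dual_le.
- move=> [i|j] f s s0 fs /=.
    rewrite (le_trans (hn i f))// -ler_pdivlMl// dual_norm_le//.
      by rewrite mulr_ge0// invr_ge0 (ltW (r0 i)).
    by move=> x; rewrite (le_trans (fs x))//= mulrA [leLHS]mulrC mulrA.
  have [b ->] : exists b, f = b *: phi j.
    apply: dual_proportional => x px; apply/eqP; rewrite -normr_le0.
    by rewrite (le_trans (fs x))//= px normr0 mul0r mulr0.
  rewrite (eq_bigr (fun k : 'I_K => b * (a j k * beta k (phi j)))) => [|k _]; last first.
    by rewrite betaZ mulrCA.
  by rewrite -mulr_sumr hf -[X in _ - X]/(b * phi j (w j)) wP subrr normr0.
exists x; split => [i|j].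
  by have := xP (inl i); rewrite /= ler_pdivrMr// mulrC.
have := xP (inr j); rewrite /= linearB/= wP ler_pdivrMr// => /le_trans; apply.
by rewrite /e mulrC divfK// gt_eqF// addr_gt0.
Qed.

(** * Isometric copies of l_1 *)

Section ell1_facts.
Context {R : realType}.

Lemma ell1_delta_subproof (m : nat) : (fun n => (n == m)%:R : R) \in @ell1_pred R.
Proof.
apply/ell1_predP; apply/cvg_ex; exists 1.
rewrite -(cvg_shiftn m.+1); apply: cvg_near_cst; near=> n.
rewrite /= -[LHS]/(\sum_(0 <= i < n + m.+1) `|(i == m)%:R : R|).
rewrite big_mkord (bigD1 (Ordinal (ltn_addl n (ltnSn m))))//= eqxx normr1 big1 ?addr0//.
by move=> i; rewrite -val_eqE/= => /negPf ->; rewrite normr0.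
Unshelve. all: by end_near. Qed.

Definition ell1_delta (m : nat) : ell1 R := Ell1 (ell1_delta_subproof m).

Lemma ell1_sumE (I : Type) (r : seq I) (u : I -> ell1 R) n :
  (\sum_(i <- r) u i : ell1 R) n = \sum_(i <- r) u i n.
Proof. by elim: r => [|i r IH]; rewrite ?big_nil// !big_cons -IH. Qed.

Lemma ell1_norm_cvg (u : ell1 R) :
  (fun N => \sum_(k < N) `|u k| : R) @ \oo --> `|u|.
Proof.
have /= := ell1_cvg (u := u); rewrite -[X in _ -> X]/(_ @ _ --> limn [normed series u]).
move=> h; rewrite (_ : (fun N => _) = [normed series u])//.
by apply/funext => N; rewrite -[RHS]/(\sum_(0 <= k < N) `|u k|) big_mkord.
Qed.

Lemma ell1_norm_mask (u v : ell1 R) (P : pred nat) N :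
  (forall k, P k -> (k < N)%N) -> (forall k, v k = if P k then 0 else u k) ->
  `|v| = `|u| - \sum_(k < N | P k) `|u k|.
Proof.
move=> PN vE; rewrite -(cvg_lim (@Rhausdorff R) (@ell1_norm_cvg v)).
apply: (cvg_lim (@Rhausdorff R)).
rewrite -(cvg_shiftn N).
have -> : (fun n => \sum_(k < n + N) `|v k|) =
    (fun n => \sum_(k < n + N) `|u k| - \sum_(k < N | P k) `|u k| : R).
  apply/funext => n; apply/eqP; rewrite eq_sym subr_eq; apply/eqP.
  rewrite (big_ord_widen_cond (n + N) P (fun k => `|u k|)) ?leq_addl//.
  rewrite [RHS]addrC [in RHS]big_mkcond -big_split/=; apply: eq_bigr => k _.
  rewrite vE; have [Pk|Pk] := boolP (P k); last by rewrite andFb add0r.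
  by rewrite PN//= normr0 addr0.
apply: cvgB; last exact: cvg_cst.
by rewrite (cvg_shiftn N (fun n => \sum_(k < n) `|u k| : R)); exact: ell1_norm_cvg.
Qed.

End ell1_facts.

(* The coordinates of an isometric copy of ell_1: [e n] are the unit vectors and
   [co f n] the coordinates of [f]. *)
Definition ell1_basis {R : realType} {V : normedModType R} (e : nat -> V)
    (co : V -> nat -> R) :=
  [/\ forall (c : R) f g n, co (c *: f + g) n = c * co f n + co g n,
      forall m n, co (e m) n = (n == m)%:R,
      forall f (P : pred nat) N, (forall k, P k -> (k < N)%N) ->
        `|f - \sum_(k < N | P k) co f k *: e k| = `|f| - \sum_(k < N | P k) `|co f k| &
      forall f, (fun N => \sum_(k < N) `|co f k| : R) @ \oo --> `|f|].

Lemma ell1_basis_exists {R : realType} {V : normedModType R} :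
  isometric_onto [set: V] [set: ell1 R] ->
  exists (e : nat -> V) (co : V -> nat -> R), ell1_basis e co.
Proof.
move=> [T [Tl Tn Tr]].
have Tlin c x y : T (c *: x + y) = c *: T x + T y by exact: Tl.
have T0 : T 0 = 0 by have := Tlin (-1) 0 0; rewrite scaler0 addr0 scaleN1r addNr.
have Tsum (I : Type) (r : seq I) (P : pred I) (a : I -> R) (x : I -> V) :
    T (\sum_(i <- r | P i) a i *: x i) = \sum_(i <- r | P i) a i *: T (x i).
  by elim: r => [|i r IH]; rewrite ?big_nil// !big_cons; case: ifP => // _; rewrite Tlin IH.
have /choice[e eE] : forall n, exists v, T v = ell1_delta n.
  move=> n; have [v _ <-] : (T @` setT) (ell1_delta n) by rewrite Tr.
  by exists v.
exists e, (fun f n => T f n); split.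
- by move=> c f g n; rewrite Tlin.
- by move=> m n; rewrite eE.
- move=> f P N PN; rewrite -!Tn//; apply: ell1_norm_mask => // k.
  have TB x y : T (x - y) = T x - T y.
    by rewrite -[x - y]addrC -scaleN1r Tlin scaleN1r addrC.
  rewrite TB Tsum -[LHS]/(T f k - (\sum_(i < N | P i) T f i *: T (e i) : ell1 R) k).
  rewrite -big_filter ell1_sumE big_filter.
  have E (i : 'I_N) : (T f i *: T (e i) : ell1 R) k = T f i * (k == i)%:R.
    by rewrite eE.
  under eq_bigr do rewrite E.
  have [Pk|Pk] := boolP (P k).
    rewrite (bigD1 (Ordinal (PN _ Pk)))//= eqxx mulr1 big1 ?addr0 ?subrr// => i.
    by move=> /andP[_]; rewrite -val_eqE/= eq_sym => /negPf ->; rewrite mulr0.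
  rewrite big1 ?subr0// => i Pi; case: eqP => [ki|]; last by rewrite mulr0.
  by rewrite ki Pi in Pk.
- by move=> f; rewrite -Tn//; exact: ell1_norm_cvg.
Qed.

(** * Coordinate estimates and the extreme points of the unit ball *)

Section ell1_basis_theory.
Context {R : realType} {V : normedModType R} (e : nat -> V) (co : V -> nat -> R).
Hypothesis He : ell1_basis e co.

Let coP := let: And4 h _ _ _ := He in h.
Let coe := let: And4 _ h _ _ := He in h.
Let co_mask := let: And4 _ _ h _ := He in h.
Let co_cvg := let: And4 _ _ _ h := He in h.

Lemma basis_norm n : `|e n| = 1.
Proof.
rewrite -(cvg_lim (@Rhausdorff R) (@co_cvg (e n))); apply: (cvg_lim (@Rhausdorff R)).
rewrite -(cvg_shiftn n.+1); apply: cvg_near_cst; near=> N.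
rewrite /= (bigD1 (Ordinal (ltn_addl N (ltnSn n))))//= coe eqxx normr1 big1 ?addr0//.
by move=> i; rewrite -val_eqE/= => /negPf ni; rewrite coe ni normr0.
Unshelve. all: by end_near. Qed.

Lemma coord_tail f N :
  `|f - \sum_(k < N) co f k *: e k| = `|f| - \sum_(k < N) `|co f k|.
Proof.
have := co_mask f (P := fun k => (k < N)%N) (fun k kN => kN).
have E (W : nmodType) (F : 'I_N -> W) : \sum_(k < N | (k < N)%N) F k = \sum_(k < N) F k.
  by apply: eq_bigl => k; rewrite ltn_ord.
by rewrite !E.
Qed.

Lemma coord_sum_le f N : \sum_(k < N) `|co f k| <= `|f|.
Proof. by rewrite -subr_ge0 -coord_tail. Qed.

Lemma coord_mask f n : `|f - co f n *: e n| = `|f| - `|co f n|.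
Proof.
have := co_mask f (P := pred1 n) (N := n.+1).
rewrite !(big_pred1 (Ordinal (ltnSn n)))//; apply=> // k /eqP -> //.
Qed.

Lemma coord_le f n : `|co f n| <= `|f|.
Proof. by rewrite -subr_ge0 -coord_mask. Qed.

Lemma tail_cvg0 f : (fun N => `|f - \sum_(k < N) co f k *: e k|) @ \oo --> (0 : R).
Proof.
rewrite -[X in _ --> X](subrr `|f|); under eq_fun do rewrite coord_tail.
by apply: cvgB; [exact: cvg_cst|exact: co_cvg].
Qed.

(** The estimate is clear on finite sections of [f]; the a priori bound [C] makes the tail disappear
    in the limit. *)
Lemma basis_functional_le (beta : V -> R) (C r : R) f :
  (forall (c : R) f g, beta (c *: f + g) = c * beta f + beta g) ->
  (forall f, `|beta f| <= C * `|f|) -> 0 <= r ->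
  (forall n, `|beta (e n)| <= r) -> `|beta f| <= r * `|f|.
Proof.
move=> bl bC r0 be; pose t N := `|f - \sum_(k < N) co f k *: e k|.
have h N : `|beta f| <= r * `|f| + C * t N.
  pose S := \sum_(k < N) co f k *: e k.
  have -> : beta f = beta S + beta (f - S).
    by have := bl 1 S (f - S); rewrite scale1r mul1r addrC subrK.
  rewrite (le_trans (ler_normD _ _))// lerD//.
  rewrite scalar_sum// (le_trans (ler_norm_sum _ _ _))//.
  rewrite (le_trans _ (ler_wpM2l r0 (coord_sum_le f N)))// mulr_sumr.
  by apply: ler_sum => k _; rewrite normrM mulrC ler_wpM2r.
have lc : (fun N => r * `|f| + C * t N) @ \oo --> r * `|f|.
  rewrite -[X in _ --> X]addr0; apply: cvgD; first exact: cvg_cst.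
  by rewrite -(mulr0 C); apply: cvgMl_tmp; exact: tail_cvg0.
apply: (@ler_cvg_to _ _ _ _ (cst `|beta f|) _ _ _ (cvg_cst _) lc).
by apply: nearW.
Qed.

Lemma coord_eq0 f : (forall n, co f n = 0) -> f = 0.
Proof.
move=> f0; apply/eqP; rewrite -normr_eq0; apply/eqP.
rewrite -(cvg_lim (@Rhausdorff R) (@co_cvg f)); apply: (cvg_lim (@Rhausdorff R)).
by apply: cvg_near_cst; near=> N; rewrite big1// => i _; rewrite f0 normr0.
Unshelve. all: by end_near. Qed.

Lemma coord_cvg0 f : co f @ \oo --> (0 : R).
Proof.
apply: norm_cvg0.
have -> : (fun n => `|co f n|) = (fun n => \sum_(k < n + 1) `|co f k| - \sum_(k < n) `|co f k|).
  by apply/funext => n; rewrite addn1 big_ord_recr/= addrAC subrr add0r.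
rewrite -[X in _ --> X](subrr `|f|); apply: cvgB; last exact: co_cvg.
by rewrite (cvg_shiftn 1 (fun n => \sum_(k < n) `|co f k| : R)); exact: co_cvg.
Qed.

(** A coordinate of modulus [t] with [0 < t < 1] displays [f] as a convex combination, with weights
    [t] and [1 - t], of a signed unit vector and the rescaled remainder, which lies in the ball
    because norms of disjoint parts add. *)
Lemma extreme_basis f : extreme_points (unit_ball V) f ->
  exists n (s : R), `|s| = 1 /\ f = s *: e n.
Proof.
rewrite /unit_ball => -[/= f1 fext].
have [f0|/existsNP[n /eqP fn]] := pselect (forall n, co f n = 0).
  have h12 : 0 < (2^-1 : R) < 1 by lra.
  have fE : f = 0 by exact: coord_eq0.
  have [|||e0 _] := fext (e 0%N) (- e 0%N) 2^-1 _ _ h12.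
  - by rewrite basis_norm.
  - by rewrite normrN basis_norm.
  - rewrite fE (_ : 1 - 2^-1 = 2^-1 :> R); last by lra.
    by rewrite scalerN subrr.
  by have := basis_norm 0; rewrite e0 fE normr0 => /eqP; rewrite eq_sym oner_eq0.
pose t := `|co f n|; pose s := co f n / t.
have t0 : 0 < t by rewrite normr_gt0.
have s1 : `|s| = 1 by rewrite normrM normfV normr_id divff// gt_eqF.
have ts : t * s = co f n by rewrite mulrC divfK// gt_eqF.
exists n, s; split => //.
have [t1|t1] := ltP t 1; last first.
  have : `|f - co f n *: e n| <= 0 by rewrite coord_mask; rewrite -/t; lra.
  rewrite normr_le0 subr_eq0 => /eqP fE; rewrite fE -ts.
  by have -> : t = 1; [have := coord_le f n; rewrite -/t; lra|rewrite mul1r].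
have u0 : 0 < 1 - t by lra.
have [||||<- //] := fext (s *: e n) ((1 - t)^-1 *: (f - co f n *: e n)) t.
- by rewrite normrZ s1 basis_norm mulr1.
- rewrite normrZ coord_mask gtr0_norm ?invr_gt0// mulrC ler_pdivrMr// mul1r -/t; lra.
- by rewrite t0.
- by rewrite !scalerA ts divff ?gt_eqF// scale1r addrC subrK.
Qed.

End ell1_basis_theory.

(** * Weak* cluster points of the extreme points, and a total sequence *)

Section dual_basis.
Context {R : realType} {X : normedModType R} (e : nat -> dual X) (co : dual X -> nat -> R).
Hypothesis He : ell1_basis e co.

Lemma dual_eval_near (g : weak_star X) (x : X) (d : R) : 0 < d ->
  \forall f \near g, `|(f : dual X) x - (g : dual X) x| < d.
Proof.
move=> d0; have /weak_star_cvgP/(_ x) /cvgr_dist_lt : nbhs g --> g by [].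
by move=> /(_ _ d0); apply: filterS => f; rewrite distrC.
Qed.

(** A point evaluation separates [p] from [g] unless they coincide. This form allows for a [g] that
    is itself a signed unit vector. *)
Lemma weak_star_avoid (g p : dual X) :
  \forall f \near (g : weak_star X), (f : dual X) = p -> p = g.
Proof.
have [->|pg] := eqVneq p g; first by apply: filterE => ? .
have [/funext pgx|/existsNP[x /eqP px]] := pselect (forall x, p x = g x).
  by case/eqP: pg; exact/val_inj.
have d0 : 0 < `|p x - g x| by rewrite normr_gt0 subr_eq0.
by apply: filterS (dual_eval_near g x d0) => f fd fp; move: fd; rewrite fp ltxx.
Qed.

(** Every weak* neighbourhood of [g] contains an extreme point other than [g], which is a signed
    unit vector. A smaller neighbourhood excludes the finitely many of index below [N]. *)
Lemma cluster_basis (g : dual X) (F : seq X) (d : R) (N : nat) :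
  weak_star_limit_points (extreme_points (unit_ball (dual X))) g -> 0 < d ->
  exists n (s : R), [/\ (N <= n)%N, `|s| = 1 & forall x, x \in F -> `|s * e n x - g x| <= d].
Proof.
move=> gl d0.
have nF : \forall f \near (g : weak_star X), forall x, x \in F -> `|(f : dual X) x - g x| <= d.
  elim: F => [|x F IH]; first by apply: filterE => ? .
  apply: filterS2 IH (dual_eval_near g x d0) => f IH fx y.
  by rewrite inE => /predU1P[->|]; [exact: ltW|exact: IH].
have nN : \forall f \near (g : weak_star X),
    forall m s, (m < N)%N -> `|s| = 1 -> (f : dual X) = s *: e m -> s *: e m = g.
  elim: N => [|N IH]; first by apply: filterE => ? .
  apply: filterS3 IH (weak_star_avoid g (e N)) (weak_star_avoid g (- e N)).
  move=> f IH f1 f2 m s; rewrite ltnS leq_eqVlt => /predU1P[->|mN]; last exact: IH.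
  move=> s1; have [->|->] : s = 1 \/ s = -1.
    by have /eqP := s1; rewrite eqr_norml => /andP[/pred2P].
  + by rewrite scale1r.
  + by rewrite scaleN1r.
have [f [/eqP fg fext [/= fF fN]]] := gl _ (filterI nF nN).
have [n [s [s1 fE]]] := extreme_basis He fext.
exists n, s; split => //; last by move=> x xF; have := fF x xF; rewrite fE.
rewrite leqNgt; apply/negP => nN'; apply: fg.
by rewrite fE; exact: fN nN' s1 fE.
Qed.

Lemma cluster_norm_le1 (g : dual X) :
  weak_star_limit_points (extreme_points (unit_ball (dual X))) g -> `|g| <= 1.
Proof.
move=> gl; apply: dual_norm_le => // x; rewrite mul1r; apply/ler_addgt0Pr => d d0.
have [n [s [_ s1 /(_ x)]]] := cluster_basis [:: x] 0 gl d0.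
rewrite mem_head => /(_ isT) h.
rewrite -[g x](subrK (s * e n x)) (le_trans (ler_normD _ _))// addrC lerD//; last by rewrite distrC.
by rewrite normrM s1 mul1r (le_trans (dual_le _ _))// (basis_norm He) mul1r.
Qed.

Lemma basis_neq0 n : e n != 0.
Proof. by rewrite -normr_gt0 (basis_norm He). Qed.

(** The [j]-th coordinate functional is an element of the bidual of norm at most 1 with the exact
    values at the [e i]; Helly's lemma replaces it by a vector of [X]. *)
Lemma approx_biorthogonal (j m : nat) : exists x : X, `|x| <= 2 /\
  forall i, (i <= m)%N -> `|e i x - (i == j)%:R| <= m.+1%:R^-1.
Proof.
have [||||||x [x1 x2]] := @helly_mixed R X unit 'I_m.+1 1 (fun _ _ => 1) (fun=> 0)
   (fun=> 1) (fun _ _ => 1) (fun i => e i) (fun i => (nat_of_ord i == j)%:R) (fun _ f => co f j)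
   (m.+1%:R^-1).
- by [].
- by move=> i; exact: basis_neq0.
- by move=> _ b f g; case: He.
- by move=> _ f; rewrite big_ord1 linear0 subr0 !mul1r (coord_le He).
- by move=> i; rewrite big_ord1 mul1r; case: He => _ -> _ _; rewrite eq_sym.
- by [].
exists (x 0%N); split=> [|i im].
  have := x1 tt; rewrite big_ord1 subr0 scale1r mul1r => /le_trans -> //.
  by rewrite -[leRHS]/(1 + 1) lerD2l invf_le1 ?ler1n.
by have := x2 (inord i); rewrite big_ord1 scale1r !inordK.
Qed.

(** This stands in for the separability of [X]. The vectors approximate the coordinate functionals,
    so a functional vanishing on all of them has zero coordinates. *)
Lemma total_sequence : exists d : nat -> X,
  forall f : dual X, (forall j, f (d j) = 0) -> f = 0.
Proof.
have /choice[d dP] : forall jm : nat * nat, exists x : X, `|x| <= 2 /\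
    forall i, (i <= jm.2)%N -> `|e i x - (i == jm.1)%:R| <= jm.2.+1%:R^-1.
  by move=> [j m]; exact: approx_biorthogonal.
exists (fun n => if unpickle n is Some jm then d jm else 0) => f fd.
have {}fd j m : f (d (j, m)) = 0 by have := fd (pickle (j, m)); rewrite pickleK.
have [coP coe _ _] := He.
apply: (coord_eq0 He) => j.
pose t N := `|f - \sum_(k < N) co f k *: e k|.
(* The first [m + 1] coordinates contribute at most [|f| / (m + 1)]; the tail counts once through
   its coordinate [j] and twice through [d (j, m)], of norm at most 2. *)
have h m : `|co f j| <= `|f| * m.+1%:R^-1 + 3 * t m.+1.
  have [xn xe] := dP (j, m); rewrite /= in xe.
  pose beta (h : dual X) := co h j - h (d (j, m)).
  have bl (c : R) (h k : dual X) : beta (c *: h + k) = c * beta h + beta k.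
    by rewrite /beta coP -[(c *: h + k) _]/(c * h _ + k _); ring.
  pose S := \sum_(k < m.+1) co f k *: e k.
  have -> : co f j = beta S + beta (f - S).
    have := bl 1 S (f - S); rewrite scale1r mul1r addrC subrK => <-.
    by rewrite /beta fd subr0.
  rewrite (le_trans (ler_normD _ _))// lerD//.
    rewrite scalar_sum// (le_trans (ler_norm_sum _ _ _))//.
    rewrite (le_trans _ (ler_wpM2r _ (coord_sum_le He f m.+1)))// mulr_suml.
    apply: ler_sum => k _; rewrite normrM ler_wpM2l// /beta coe distrC eq_sym.
    by apply: xe; rewrite -ltnS.
  rewrite /beta (le_trans (ler_normB _ _))// -/(t _).
  have -> : 3 * t m.+1 = t m.+1 + t m.+1 * 2 by ring.
  by rewrite lerD ?(coord_le He)// (le_trans (dual_le _ _))// ler_wpM2l.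
have lc : (fun m => `|f| * m.+1%:R^-1 + 3 * t m.+1) @ \oo --> (0 : R).
  rewrite -[X in _ --> X]addr0; apply: cvgD.
    by rewrite -[X in _ --> X](mulr0 `|f|); apply: cvgMl_tmp; exact: cvg_harmonic.
  rewrite -[X in _ --> X](mulr0 3); apply: cvgMl_tmp.
  have := tail_cvg0 He f; rewrite -(cvg_shiftS t); exact.
apply/eqP; rewrite -normr_le0.
by apply: (@ler_cvg_to _ _ _ _ (cst `|co f j|) _ _ _ (cvg_cst _) lc); apply: nearW.
Qed.

End dual_basis.

(** * Operators from finite-dimensional subspaces of W_alpha *)

Section finite_operators.
Context {R : realType} {X : normedModType R} (a : R).
Implicit Types (y : nat -> R) (x : nat -> X).

(* Coordinates of [y] on the vectors (1, a, a, ...), e_1, e_2, ... of W_alpha. *)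
Definition coef y k : R := if k == 0%N then y 0%N else y k - a * y 0%N.

(** The operator sending the [k]-th of these vectors to [x k]. It reads only the terms of [y] of
    index below [K], so it makes sense on every sequence and factors through the truncation to
    [F_K]. *)
Definition Sop K x y : X := \sum_(k < K) coef y k *: x k.

Lemma coef_comb c y z k : coef (fun i => c * y i + z i) k = c * coef y k + coef z k.
Proof. by rewrite /coef; case: ifP => // _; ring. Qed.

Lemma Sop_comb K x c y z :
  Sop K x (fun i => c * y i + z i) = c *: Sop K x y + Sop K x z.
Proof.
rewrite /Sop scaler_sumr -big_split/=; apply: eq_bigr => k _.
by rewrite coef_comb scalerDl scalerA.
Qed.

Lemma Sop_local K x y z : (forall i, (i < K)%N -> y i = z i) -> Sop K x y = Sop K x z.
Proof.
move=> yz; apply: eq_bigr => k _; rewrite /coef yz ?(leq_ltn_trans _ (ltn_ord k))//.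
by rewrite yz.
Qed.

Definition wbasis k i : R := if k == 0%N then (if i == 0%N then 1 else a) else (i == k)%:R.

(** The first [K] terms of [y] agree with those of its expansion in the [wbasis k]. This gives the
    bidual targets the form that [helly_mixed] expects. *)
Lemma coef_expand K (h : (nat -> R) -> R) y : (0 < K)%N ->
  (forall c y z, h (fun i => c * y i + z i) = c * h y + h z) ->
  (forall y z, (forall i, (i < K)%N -> y i = z i) -> h y = h z) ->
  h y = \sum_(k < K) coef y k * h (wbasis k).
Proof.
move=> K0 hl hloc.
rewrite -(@scalar_sum R (nat -> R^o) (h : (nat -> R^o) -> R) _ (index_enum _)
  (fun k : 'I_K => coef y k) (fun k : 'I_K => wbasis k : nat -> R^o)); last exact: hl.
apply: hloc => i iK; rewrite fct_sumE.
transitivity (\sum_(k < K) coef y k * wbasis k i); last by [].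
have [->|i0] := eqVneq i 0%N.
  rewrite (bigD1 (Ordinal K0))//= /wbasis/= mulr1 big1 ?addr0// => k.
  by rewrite -val_eqE/= => k0; rewrite (negPf k0) eq_sym (negPf k0) mulr0.
have ik : Ordinal iK != Ordinal K0 by rewrite -val_eqE.
rewrite (bigD1 (Ordinal K0))//= (bigD1 (Ordinal iK))//= /wbasis/= (negPf i0) eqxx big1.
  by rewrite /coef/= (negPf i0); ring.
move=> k /andP[]; rewrite -!val_eqE/= => k0 ki; rewrite (negPf k0) eq_sym (negPf ki).
by rewrite mulr0.
Qed.

End finite_operators.

(** The cube is the convex hull of its sign vectors, so a convex condition on the ball of l_oo^K
    reduces to finitely many cases. Coordinates are freed one at a time. *)
Lemma cube_convex {R : realType} (A : (nat -> R) -> Prop) (K : nat) :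
  (forall y z t, 0 <= t <= 1 -> A y -> A z -> A (fun i => t * y i + (1 - t) * z i)) ->
  (forall y, (forall i, (i < K)%N -> `|y i| = 1) -> A y) ->
  forall y, (forall i, (i < K)%N -> `|y i| <= 1) -> A y.
Proof.
move=> cA sA.
suff H j : (j <= K)%N -> forall y, (forall i, (i < j)%N -> `|y i| <= 1) ->
    (forall i, (j <= i < K)%N -> `|y i| = 1) -> A y.
  by move=> y y1; apply: (H K) => // i /andP[Ki iK]; have := leq_ltn_trans Ki iK; rewrite ltnn.
elim: j => [_ y _ y1|j IH jK y y1 y2]; first by apply: sA => i iK; exact: y1.
pose z (u : R) i := if i == j then u else y i.
have zA u : `|u| = 1 -> A (z u).
  move=> u1; apply: IH; first exact: ltnW.
    move=> i ij; rewrite /z; case: eqP => [_|_]; first by rewrite u1.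
    by apply: y1; rewrite ltnS ltnW.
  move=> i /andP[ji iK]; rewrite /z; case: eqP => [//|/eqP ne].
  by apply: y2; rewrite iK andbT ltn_neqAle eq_sym ne.
pose t := (1 + y j) / 2.
have /ler_normlP[yj1 yj2] := y1 j (ltnSn j).
have -> : y = fun i => t * z 1 i + (1 - t) * z (-1) i.
  by apply/funext => i; rewrite /z /t; case: eqP => [->|_]; field.
apply: cA; first by rewrite /t; lra.
  by apply: zA; rewrite normr1.
by apply: zA; rewrite normrN1.
Qed.

(** * The exact solution in the bidual *)

Section bidual_target.
Context {R : realType} {X : normedModType R} (e : nat -> dual X) (co : dual X -> nat -> R).
Hypothesis He : ell1_basis e co.
Variables (g : dual X) (a : R).
Hypotheses (a0 : 0 < a) (ag : a < `|g|) (g1 : `|g| <= 1).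
Variables (K : nat) (n : nat -> nat) (s : nat -> R) (x : nat -> X) (d : R).
Hypotheses (K0 : (0 < K)%N) (d0 : 0 < d) (d2 : d <= 2).
Hypothesis s1 : forall k, (k <= K)%N -> `|s k| = 1.
Hypothesis n_inj : forall j k, (j <= K)%N -> (k <= K)%N -> n j = n k -> j = k.

Let S y := Sop a K x y.
Let gam := `|g| - a.

Hypothesis S_norm : forall y, (forall i, (i < K)%N -> `|y i| <= 1) -> `|S y| <= 1 + d.
Hypothesis S_coord : forall y, (forall i, (i < K)%N -> `|y i| <= 1) ->
  forall k, (k < K)%N -> `|s k * e (n k) (S y) - y k| <= d.
Hypothesis S_g : forall y, (forall i, (i < K)%N -> `|y i| <= 1) -> `|g (S y) - a * y 0%N| <= d.
Hypothesis g_small : \sum_(k < K) `|co g (n k)| <= gam / 8.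
Hypothesis gK_small : `|co g (n K)| <= gam / 32 * d.
Hypothesis eK_near : forall y, (forall i, (i < K)%N -> `|y i| = 1) ->
  `|s K * e (n K) (S y) - g (S y)| <= d.
Variable N : dual X -> R.
Hypothesis N_lin : forall c f h, N (c *: f + h) = c * N f + N h.
Hypothesis N_le : forall f, `|N f| <= `|f|.
Hypothesis N_g : N g = `|g|.

(** The constant [8 / gam] makes the shrunk coordinates, of modulus at most [shrink * (1 + d)],
    leave enough space below 1 for the correction. *)
Definition shrink := (1 + 8 / gam * d)^-1.
Definition correction (y : nat -> R) : R := a * y 0%N
  - \sum_(k < K.+1) co g (n k) * (s k * y k)
  - shrink * (g (S y) - \sum_(k < K.+1) co g (n k) * e (n k) (S y)).
(** The value at [g] of [N] stripped of its coordinates at the prescribed [e (n k)], as only the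
    others are free to move. *)
Definition room : R := N g - \sum_(k < K.+1) co g (n k) * N (e (n k)).
Definition generic (y : nat -> R) (f : dual X) : R := shrink * f (S y) + correction y / room * N f.
(* An element of the bidual, given by its action on X^*: its coordinate at
   [e (n k)] is [s k * y k], and at the other basis vectors it is that of
   [generic]; [correction] is chosen so that its value at [g] is [a * y 0]. *)
Definition target (y : nat -> R) (f : dual X) : R :=
  generic y f + \sum_(k < K.+1) (s k * y k - generic y (e (n k))) * co f (n k).

Let gam0 : 0 < gam. Proof. by rewrite subr_gt0. Qed.
Let gam1 : gam <= 1. Proof. by have := a0; have := g1; rewrite /gam; lra. Qed.
Let coP (c : R) f h m : co (c *: f + h) m = c * co f m + co h m.
Proof. by case: He. Qed.
Let coe m k : co (e m) k = (k == m)%:R. Proof. by case: He. Qed.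
Let e_norm m : `|e m| = 1. Proof. exact: basis_norm He m. Qed.

Lemma generic_lin y c f h : generic y (c *: f + h) = c * generic y f + generic y h.
Proof. by rewrite /generic N_lin -[(c *: f + h) _]/(c * f _ + h _); ring. Qed.

Lemma target_lin y c f h : target y (c *: f + h) = c * target y f + target y h.
Proof.
rewrite /target generic_lin [c * (_ + \sum_(k < _) _)]mulrDr addrACA.
rewrite mulr_sumr -big_split/=; congr (_ + _).
by apply: eq_bigr => k _; rewrite coP; ring.
Qed.

Let SE c y z : S (fun i => c * y i + z i) = c *: S y + S z.
Proof. exact: Sop_comb. Qed.

Let fSE (f : dual X) c y z : f (S (fun i => c * y i + z i)) = c * f (S y) + f (S z).
Proof. by rewrite SE linearD linearZ. Qed.

Lemma correction_comb c y z : correction (fun i => c * y i + z i) = c * correction y + correction z.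
Proof.
rewrite /correction fSE.
have -> : \sum_(k < K.+1) co g (n k) * (s k * (c * y k + z k)) =
    c * (\sum_(k < K.+1) co g (n k) * (s k * y k)) + \sum_(k < K.+1) co g (n k) * (s k * z k).
  by rewrite mulr_sumr -big_split/=; apply: eq_bigr => k _; ring.
have -> : \sum_(k < K.+1) co g (n k) * e (n k) (S (fun i => c * y i + z i)) =
    c * (\sum_(k < K.+1) co g (n k) * e (n k) (S y)) + \sum_(k < K.+1) co g (n k) * e (n k) (S z).
  by rewrite mulr_sumr -big_split/=; apply: eq_bigr => k _; rewrite fSE; ring.
by ring.
Qed.

Lemma generic_comb c y z f : generic (fun i => c * y i + z i) f = c * generic y f + generic z f.
Proof. by rewrite /generic correction_comb fSE; ring. Qed.

Lemma target_comb c y z f : target (fun i => c * y i + z i) f = c * target y f + target z f.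
Proof.
rewrite /target generic_comb [c * (_ + \sum_(k < _) _)]mulrDr addrACA.
rewrite mulr_sumr -big_split/=; congr (_ + _).
by apply: eq_bigr => k _; rewrite generic_comb; ring.
Qed.

Lemma target_local y z f : (forall i, (i < K.+1)%N -> y i = z i) -> target y f = target z f.
Proof.
move=> yz; have SS : S y = S z by apply: Sop_local => i iK; apply: yz; exact: ltnW.
have rr : correction y = correction z.
  rewrite /correction SS yz//; congr (_ - _ - _); by apply: eq_bigr => k _; rewrite yz.
rewrite /target /generic SS rr; congr (_ + _); apply: eq_bigr => k _; by rewrite yz.
Qed.

Lemma target_basis y k : (k <= K)%N -> target y (e (n k)) = s k * y k.
Proof.
move=> kK; rewrite /target (bigD1 (Ordinal (kK : k < K.+1)%N))//= coe eqxx mulr1 big1 ?addr0.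
  by rewrite addrC subrK.
move=> j; rewrite -val_eqE/= coe => jk; case: eqP => [/n_inj|]; last by rewrite mulr0.
by rewrite -ltnS ltn_ord => /(_ isT kK) jk'; rewrite jk' eqxx in jk.
Qed.

Lemma target_off y m : (forall k, (k <= K)%N -> m != n k) -> target y (e m) = generic y (e m).
Proof.
move=> mn; rewrite /target big1 ?addr0// => k _.
by rewrite coe eq_sym (negPf (mn _ _)) ?mulr0// -ltnS.
Qed.

Let G_small : \sum_(k < K.+1) `|co g (n k)| <= gam / 4.
Proof.
rewrite big_ord_recr/=; have : gam * d <= gam * 2 by rewrite ler_pM2l.
by have := gam0; have := g_small; have := gK_small; lra.
Qed.

Lemma room_ge : `|g| - \sum_(k < K.+1) `|co g (n k)| <= room.
Proof.
rewrite /room N_g lerD2l lerN2; apply: ler_sum => k _.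
rewrite (le_trans (ler_norm _))// normrM ler_piMr// (le_trans (N_le _))//.
by rewrite e_norm.
Qed.

Lemma room_gt0 : 0 < room.
Proof. by have := room_ge; have := G_small; have := a0; have := gam0; rewrite /gam; lra. Qed.

Let c_ge8 : 8 <= 8 / gam.
Proof. by rewrite ler_pdivlMr// ler_piMr. Qed.

Let scale_gt0 : 0 < shrink.
Proof. by rewrite invr_gt0 addr_gt0// mulr_gt0// divr_gt0. Qed.

Let scaleE : shrink * (1 + 8 / gam * d) = 1.
Proof. by rewrite /shrink mulVf// gt_eqF// -invr_gt0. Qed.

(** The multiple of [N] that repairs the value at [g] fits into the space left by shrinking. Both
    sides carry the factor [shrink * d]; what remains is at most [8 / gam * (a + th) + 3] on the
    left and at least [(8 / gam - 1) * (|g| - th)] on the right. *)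
Lemma correction_le y : (forall i, (i <= K)%N -> `|y i| <= 1) ->
  `|correction y| <= (1 - shrink * (1 + d)) * room.
Proof.
move=> y1; have y1' i : (i < K)%N -> `|y i| <= 1 by move=> iK; apply: y1; exact: ltnW.
pose th := \sum_(k < K.+1) `|co g (n k)|.
pose A := a * y 0%N - \sum_(k < K.+1) co g (n k) * (s k * y k).
pose C := \sum_(k < K.+1) co g (n k) * (e (n k) (S y) - s k * y k).
(* The three terms are the loss due to shrinking, the error of [S y] at [g], and its error at the
   prescribed coordinates. *)
have rE : correction y = (1 - shrink) * A + shrink * (a * y 0%N - g (S y)) + shrink * C.
  rewrite /correction /A /C.
  have -> : \sum_(k < K.+1) co g (n k) * (e (n k) (S y) - s k * y k) =
    \sum_(k < K.+1) co g (n k) * e (n k) (S y) - \sum_(k < K.+1) co g (n k) * (s k * y k).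
    by rewrite -sumrB; apply: eq_bigr => k _; rewrite mulrBr.
  by ring.
have A_le : `|A| <= a + th.
  rewrite (le_trans (ler_normB _ _))// lerD//.
    by rewrite normrM (gtr0_norm a0) ler_piMr ?y1// ltW.
  rewrite (le_trans (ler_norm_sum _ _ _))//; apply: ler_sum => k _.
  have kK : (k <= K)%N by rewrite -ltnS.
  by rewrite !normrM s1// mul1r ler_piMr// y1.
(* The first [K] coordinates are accurate up to [d] and have total weight at most 1. The error at
   the new one is only bounded by 4, but its weight is at most [gam / 32 * d]. *)
have C_le : `|C| <= 2 * d.
  rewrite /C big_ord_recr/= (le_trans (ler_normD _ _))//.
  have -> : 2 * d = 1 * d + d by ring.
  rewrite lerD//.
    rewrite (le_trans (ler_norm_sum _ _ _))//.
    have : \sum_(k < K) `|co g (n k)| <= 1 by have := g_small; have := gam1; lra.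
    move=> /(ler_wpM2r (ltW d0)); apply: le_trans; rewrite mulr_suml.
    apply: ler_sum => k _; rewrite normrM ler_wpM2l//.
    have := S_coord y1' (ltn_ord k).
    rewrite -[X in X <= _ -> _]mul1r -(s1 (ltnW (ltn_ord k))) -normrM mulrBr mulrA.
    have -> : s k * s k = 1 by rewrite -expr2 -real_normK ?num_real// s1 ?expr1n// ltnW.
    by rewrite mul1r.
  rewrite normrM; have : `|e (n K) (S y) - s K * y K| <= 4.
    rewrite (le_trans (ler_normB _ _))// normrM s1// mul1r.
    have := dual_le (e (n K)) (S y); rewrite e_norm mul1r.
    by have := S_norm y1'; have := y1 K (leqnn _); have := d2; lra.
  move=> h4; have := ler_pM (normr_ge0 _) (normr_ge0 _) gK_small h4.
  move/le_trans; apply; have : gam * d <= 1 * d by rewrite ler_pM2r.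
  by have := d0; lra.
have D_le : `|a * y 0%N - g (S y)| <= d by rewrite distrC S_g.
have th0 : 0 <= th by rewrite sumr_ge0.
have scaleB : 1 - shrink = 8 / gam * d * shrink by have := scaleE; lra.
have cd0 : 0 <= 8 / gam * d * shrink by rewrite !mulr_ge0 ?ltW// invr_gt0.
have {}rE : `|correction y| <= shrink * d * (8 / gam * (a + th) + 3).
  rewrite rE (le_trans (ler_normD _ _))// (le_trans (lerD (ler_normD _ _) (lexx _)))//.
  rewrite !normrM (gtr0_norm scale_gt0) scaleB (ger0_norm cd0).
  have := ler_wpM2l cd0 A_le; have := ler_wpM2l (ltW scale_gt0) C_le.
  by have := ler_wpM2l (ltW scale_gt0) D_le; lra.
apply: (le_trans rE).
have -> : (1 - shrink * (1 + d)) * room = shrink * d * ((8 / gam - 1) * room).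
  by have -> : 1 - shrink * (1 + d) = shrink * d * (8 / gam - 1);
    [have := scaleE; lra|rewrite mulrA].
rewrite ler_wpM2l ?mulr_ge0 ?(ltW scale_gt0) ?(ltW d0)//.
have : (8 / gam - 1) * (`|g| - th) <= (8 / gam - 1) * room.
  rewrite ler_wpM2l ?room_ge//; have := c_ge8; lra.
apply: le_trans.
(* As [th <= gam / 4], half of [gam] survives; times [8 / gam] this is 4, which covers 3 and
   [|g| - th <= 1]. *)
have h : 8 / gam * (gam / 2) <= 8 / gam * (`|g| - a - 2 * th).
  rewrite ler_wpM2l//; first by rewrite divr_ge0// ltW.
  by have := G_small; rewrite -/th /gam; lra.
have : 8 / gam * (gam / 2) = 4 by field; rewrite gt_eqF.
by move: h; have := g1; lra.
Qed.

(** Off the prescribed coordinates, the multiple of [N] contributes [correction y / room * room] at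
    [g], which is what was missing. *)
Lemma target_g y : target y g = a * y 0%N.
Proof.
rewrite /target {1}/generic.
have -> : \sum_(k < K.+1) (s k * y k - generic y (e (n k))) * co g (n k) =
    \sum_(k < K.+1) co g (n k) * (s k * y k)
    - shrink * (\sum_(k < K.+1) co g (n k) * e (n k) (S y))
    - correction y / room * (\sum_(k < K.+1) co g (n k) * N (e (n k))).
  by rewrite !mulr_sumr -!sumrB; apply: eq_bigr => k _; rewrite /generic; ring.
have h : correction y / room * (N g - \sum_(k < K.+1) co g (n k) * N (e (n k))) = correction y.
  by rewrite -/room divfK// gt_eqF// room_gt0.
have hr : correction y = a * y 0%N - \sum_(k < K.+1) co g (n k) * (s k * y k)
  - shrink * (g (S y) - \sum_(k < K.+1) co g (n k) * e (n k) (S y)) by [].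
move: h hr; set r := correction y; set w := room.
set G1 := \sum_(k < K.+1) _; set G2 := \sum_(k < K.+1) _; set G3 := \sum_(k < K.+1) _.
by lra.
Qed.

Lemma target_bounded y : exists C, forall f, `|target y f| <= C * `|f|.
Proof.
exists (`|shrink| * `|S y| + `|correction y / room|
  + \sum_(k < K.+1) `|s k * y k - generic y (e (n k))|).
move=> f; rewrite /target 2!mulrDl (le_trans (ler_normD _ _))// lerD//.
  apply: le_trans (ler_normD _ _) _; apply: lerD; rewrite [leLHS]normrM; last by rewrite ler_wpM2l.
  by rewrite -mulrA ler_wpM2l// mulrC dual_le.
rewrite (le_trans (ler_norm_sum _ _ _))// mulr_suml; apply: ler_sum => k _.
by rewrite normrM ler_wpM2l// (coord_le He).
Qed.

(** It suffices to test unit vectors. The prescribed coordinates have modulus [|y k|]; the others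
    are at most [shrink * (1 + d)] plus the space that this leaves below 1. *)
Lemma target_le y f : (forall i, (i <= K)%N -> `|y i| <= 1) -> `|target y f| <= `|f|.
Proof.
move=> y1; have [C tC] := target_bounded y.
rewrite -[leRHS]mul1r; apply: (basis_functional_le He (beta := target y) (C := C)) => // [c h k|m].
  exact: target_lin.
have [[k [kK ->]]|/forallNP mn] := pselect (exists k, (k <= K)%N /\ m = n k).
  by rewrite target_basis// normrM s1// mul1r y1.
rewrite target_off => [|k kK]; last by apply/eqP => mk; exact: mn k (conj kK mk).
rewrite /generic (le_trans (ler_normD _ _))// !normrM (gtr0_norm scale_gt0).
have S1 : `|e m (S y)| <= 1 + d.
  rewrite (le_trans (dual_le _ _))// e_norm mul1r S_norm// => i iK.
  by apply: y1; exact: ltnW.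
have : `|correction y| * `|room^-1| * `|N (e m)| <= 1 - shrink * (1 + d).
  rewrite -[leRHS]mulr1 ler_pM ?mulr_ge0//; last by rewrite (le_trans (N_le _))// e_norm.
  by rewrite [`|room^-1|]gtr0_norm ?invr_gt0 ?room_gt0// ler_pdivrMr ?room_gt0// correction_le.
by have := ler_wpM2l (ltW scale_gt0) S1; lra.
Qed.

(** The comparison is again made on unit vectors. At [e (n K)] both values are close to [a * y 0],
    through [g (S y)]. At the unprescribed ones the correction costs at most [8 / gam * d] and the
    shrinking at most three times as much. *)
Lemma target_near y f : (forall i, (i < K)%N -> `|y i| = 1) -> y K = a * y 0%N ->
  `|target y f - f (S y)| <= 32 / gam * d * `|f|.
Proof.
move=> y1 yK; have y1' i : (i <= K)%N -> `|y i| <= 1.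
  rewrite leq_eqVlt => /predU1P[->|/y1 ->//].
  by rewrite yK normrM y1// mulr1 gtr0_norm//; have := ag; have := g1; lra.
have y1'' i : (i < K)%N -> `|y i| <= 1 by move=> /y1 ->.
have [C tC] := target_bounded y.
have cd : 4 * d <= 32 / gam * d.
  rewrite ler_pM2r//; have := c_ge8; lra.
apply: (basis_functional_le He (beta := fun f => target y f - f (S y)) (C := C + `|S y|)).
- by move=> c h k; rewrite target_lin -[(c *: h + k) _]/(c * h _ + k _); ring.
- move=> h; rewrite (le_trans (ler_normB _ _))// mulrDl lerD//.
  by rewrite mulrC dual_le.
- by rewrite mulr_ge0 ?divr_ge0// ltW.
move=> m.
have [[k [kK ->]]|/forallNP mn] := pselect (exists k, (k <= K)%N /\ m = n k).
  rewrite target_basis//.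
  have -> : `|s k * y k - e (n k) (S y)| = `|s k * e (n k) (S y) - y k|.
    rewrite -[RHS]mul1r -(s1 kK) -normrM mulrBr mulrA.
    have -> : s k * s k = 1 by rewrite -expr2 -real_normK ?num_real// s1 ?expr1n.
    by rewrite mul1r distrC.
  have [kK'|kK'] := ltnP k K.
    by have := S_coord y1'' kK'; have := d0; lra.
  have -> : k = K by apply/eqP; rewrite eqn_leq kK.
  rewrite yK -[s K * _](subrK (g (S y))) -addrA (le_trans (ler_normD _ _))//.
  by have := eK_near y1; have := S_g y1''; have := d0; lra.
rewrite target_off => [|k kK]; last by apply/eqP => mk; exact: mn k (conj kK mk).
have S1 : `|e m (S y)| <= 1 + d.
  by rewrite (le_trans (dual_le _ _))// e_norm mul1r S_norm.
have r1 : `|correction y / room * N (e m)| <= 1 - shrink * (1 + d).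
  rewrite !normrM -[leRHS]mulr1 ler_pM ?mulr_ge0//; last by rewrite (le_trans (N_le _))// e_norm.
  by rewrite [`|room^-1|]gtr0_norm ?invr_gt0 ?room_gt0// ler_pdivrMr ?room_gt0// correction_le.
rewrite /generic; have -> : shrink * e m (S y) + correction y / room * N (e m) - e m (S y) =
   correction y / room * N (e m) - (1 - shrink) * e m (S y) by ring.
have scaleB : 1 - shrink = 8 / gam * d * shrink by have := scaleE; lra.
have cd0 : 0 <= 8 / gam * d * shrink by rewrite !mulr_ge0 ?ltW// invr_gt0.
have scale_le1 : shrink <= 1 by lra.
rewrite (le_trans (ler_normB _ _))// [`|(1 - shrink) * _|]normrM scaleB (ger0_norm cd0).
have h1 := ler_wpM2l cd0 S1.
have h2 : 8 / gam * d * shrink * (1 + d) <= 8 / gam * d * 1 * 3.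
  rewrite ler_pM//; first by rewrite addr_ge0// ltW.
    by rewrite ler_pM2l// mulr_gt0// divr_gt0.
  have := d2; lra.
have h3 : 8 / gam * d * shrink <= 8 / gam * d * 1 by rewrite ler_pM2l// mulr_gt0// divr_gt0.
have h4 : 0 <= shrink * d by rewrite mulr_ge0 ?ltW.
by lra.
Qed.

End bidual_target.

(** * One step of the construction, from [F_K] to [F_(K+1)] *)

Definition sgnv {R : realType} (K : nat) (th : {ffun 'I_K -> bool}) (i : nat) : R :=
  if insub i is Some j then (-1) ^+ th j else 0.

Lemma sgnv_norm {R : realType} K (th : {ffun 'I_K -> bool}) i :
  (i < K)%N -> `|sgnv (R := R) th i| = 1.
Proof. by move=> iK; rewrite /sgnv insubT normrX normrN1 expr1n. Qed.

Lemma sgnv_surj {R : realType} K (y : nat -> R) : (forall i, (i < K)%N -> `|y i| = 1) ->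
  exists th : {ffun 'I_K -> bool}, forall i, (i < K)%N -> sgnv th i = y i.
Proof.
move=> y1; exists [ffun j : 'I_K => y j < 0] => i iK.
rewrite /sgnv insubT ffunE/=; have /eqP := y1 _ iK; rewrite eqr_norml => /andP[/pred2P[] -> _].
  by rewrite ltr10.
by rewrite ltrN10 expr1.
Qed.

Section step.
Context {R : realType} {X : normedModType R} (e : nat -> dual X) (co : dual X -> nat -> R).
Hypothesis He : ell1_basis e co.
Variables (g : dual X) (a : R).
Hypotheses (a0 : 0 < a) (ag : a < `|g|) (g1 : `|g| <= 1).
Hypothesis g_cluster :
  weak_star_limit_points (extreme_points (unit_ball (dual X))) g.

(* [x] defines an operator on F_K meeting the requirements up to [d]; the sum
   keeps enough of the norm of [g] outside the prescribed coordinates. *)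
Definition stage K (n : nat -> nat) (s : nat -> R) (x : nat -> X) (d : R) :=
  [/\ forall k, (k < K)%N -> `|s k| = 1,
      forall j k, (j < K)%N -> (k < K)%N -> n j = n k -> j = k,
      forall y, (forall i, (i < K)%N -> `|y i| <= 1) ->
        [/\ `|Sop a K x y| <= 1 + d,
            forall k, (k < K)%N -> `|s k * e (n k) (Sop a K x y) - y k| <= d &
            `|g (Sop a K x y) - a * y 0%N| <= d] &
      \sum_(k < K) `|co g (n k)| + (`|g| - a) / 32 * d <= (`|g| - a) / 8].

Lemma norming_functional : exists N : dual X -> R,
  [/\ forall c f h, N (c *: f + h) = c * N f + N h, forall f, `|N f| <= `|f| & N g = `|g|].
Proof.
have [|N [Nl Nle Ng]] := @hahn_banach_sublinear R (dual X) (fun f => `|f|) g.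
  split=> [f h|c f c0]; first exact: ler_normD.
  by rewrite normrZ gtr0_norm.
exists N; split => // f; rewrite ler_norml Nle andbT lerNl.
have N0 : N 0 = 0 by have := Nl 1 0 0; rewrite scale1r addr0; lra.
have -> : - N f = N (- f) by have := Nl (-1) f 0; rewrite addr0 scaleN1r N0; lra.
by rewrite (le_trans (Nle _))// normrN.
Qed.

(** The exact solution [target] in the bidual is brought back into [X] by [helly_mixed] with
    tolerance [d / 2]. The constraints are imposed on sign vectors, hence finite in number, and
    spread to the cube by convexity. *)
Lemma stage_extend K n s x d : (0 < K)%N -> 0 < d -> d <= 2 ->
  stage K n s x d ->
  (forall k, (k <= K)%N -> `|s k| = 1) ->
  (forall j k, (j <= K)%N -> (k <= K)%N -> n j = n k -> j = k) ->
  `|co g (n K)| <= (`|g| - a) / 64 * d ->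
  (forall y, (forall i, (i < K)%N -> `|y i| = 1) ->
    `|s K * e (n K) (Sop a K x y) - g (Sop a K x y)| <= d) ->
  exists x', stage K.+1 n s x' (d / 2) /\
    forall y, (forall i, (i < K)%N -> `|y i| <= 1) -> y K = a * y 0%N ->
      `|Sop a K.+1 x' y - Sop a K x y| <= 64 / (`|g| - a) * d.
Proof.
move=> K0 d0 d2 [_ _ st gs] s1 n_inj gK eK.
have gam0 : 0 < `|g| - a by rewrite subr_gt0.
have gamd : 0 < (`|g| - a) * d by rewrite mulr_gt0.
have S1 y (y1 : forall i, (i < K)%N -> `|y i| <= 1) := let: And3 h _ _ := st y y1 in h.
have S2 y (y1 : forall i, (i < K)%N -> `|y i| <= 1) := let: And3 _ h _ := st y y1 in h.
have S3 y (y1 : forall i, (i < K)%N -> `|y i| <= 1) := let: And3 _ _ h := st y y1 in h.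
have gs' : \sum_(k < K) `|co g (n k)| <= (`|g| - a) / 8 by lra.
have gK' : `|co g (n K)| <= (`|g| - a) / 32 * d by lra.
have [N [Nl Nle Ng]] := norming_functional.
pose tgt y f := target e co g a K n s x d N y f.
(* The inclusion of [F_K] into [F_(K+1)]. *)
pose ext (y : nat -> R) i := if (i < K)%N then y i else a * y 0%N.
(* Index types for the constraints at sign vectors: [inl] bounds the norm of the new operator, [inr]
   keeps it near the old one; in [J], [Some k] prescribes the value at [e (n k)] and [None] that at
   [g]. *)
pose I := ({ffun 'I_K.+1 -> bool} + {ffun 'I_K -> bool})%type.
pose J := ({ffun 'I_K.+1 -> bool} * option 'I_K.+1)%type.
pose c (i : I) k :=
  match i with inl th => coef a (sgnv th) k | inr th => coef a (ext (sgnv th)) k end.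
pose z (i : I) := match i with inl th => 0 | inr th => Sop a K x (sgnv th) end.
pose r (i : I) := match i with inl th => 1 | inr th => 32 / (`|g| - a) * d end.
pose cj (j : J) k := coef a (sgnv j.1) k.
pose phi (j : J) := if j.2 is Some k then e (n k) else g.
pose t (j : J) : R := if j.2 is Some k then s k * sgnv j.1 k else a * sgnv j.1 0%N.
have tgtE y f : \sum_(k < K.+1) coef a y k * tgt (wbasis a k) f = tgt y f.
  rewrite -(@coef_expand R a K.+1 (fun y => tgt y f))//.
    by move=> b u v; exact: target_comb.
  by move=> u v; exact: target_local.
have [||||||x' [x1 x2]] := @helly_mixed R X I J K.+1 c z r cj phi t
    (fun k f => tgt (wbasis a k) f) (d / 2).
- move=> [th|th] //=; rewrite mulr_gt0// divr_gt0//.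
- move=> [th [k|]]; rewrite /phi/=; first exact: basis_neq0 He _.
  by rewrite -normr_gt0 (lt_trans a0).
- by move=> k b f h; exact: target_lin.
- move=> [th|th] f /=; rewrite tgtE.
    rewrite linear0 subr0 mul1r; apply: target_le => // i iK; by rewrite sgnv_norm.
  have <- : Sop a K x (ext (sgnv th)) = Sop a K x (sgnv th).
    by apply: Sop_local => i iK; rewrite /ext iK.
  apply: target_near => //; first by move=> i iK; rewrite /ext iK sgnv_norm.
  by rewrite /ext ltnn K0.
- move=> [th [k|]]; rewrite /cj /phi /t/= tgtE.
    by apply: target_basis; rewrite // -ltnS.
  exact: target_g.
- by rewrite divr_gt0.
have cvx (W : normedModType R) (L : (nat -> R) -> W) (b : R) :
    (forall c y z, L (fun i => c * y i + z i) = c *: L y + L z) ->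
    forall y z t, 0 <= t <= 1 -> `|L y| <= b -> `|L z| <= b ->
      `|L (fun i => t * y i + (1 - t) * z i)| <= b.
  move=> Ll y u q /andP[q0 q1] yb ub.
  have -> : L (fun i => q * y i + (1 - q) * u i) = q *: L y + (1 - q) *: L u.
    have L0 : L (fun=> 0) = 0.
      have := Ll 1 (fun=> 0) (fun=> 0); rewrite mulr0 addr0 scale1r => /eqP.
      by rewrite eq_sym -subr_eq0 addrK => /eqP.
    rewrite Ll; congr (_ + _); have := Ll (1 - q) u (fun=> 0).
    by under eq_fun do rewrite addr0; rewrite L0 addr0.
  have p0 : 0 <= 1 - q by rewrite subr_ge0.
  rewrite (le_trans (ler_normD _ _))// !normrZ (ger0_norm q0) (ger0_norm p0).
  by have := ler_wpM2l q0 yb; have := ler_wpM2l p0 ub; lra.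
exists x'; split.
  split => //.
    move=> y y1; split.
    + move: y y1; apply: cube_convex => [|y y1].
        by apply: cvx => b u v; exact: Sop_comb.
      have [th thE] := sgnv_surj y1.
      have := x1 (inl th); rewrite /= subr0 mul1r -/(Sop a K.+1 x' (sgnv th)).
      by rewrite (Sop_local _ _ thE).
    + move=> k kK; move: y y1; apply: cube_convex => [|y y1].
        apply: (cvx R^o (fun y => s k * e (n k) (Sop a K.+1 x' y) - y k)) => b u v.
        by rewrite Sop_comb linearD linearZ/= -![_ *: _]/(_ * _); ring.
      have [th thE] := sgnv_surj y1.
      have := x2 (th, Some (Ordinal kK)); rewrite /phi /t /= -/(Sop a K.+1 x' (sgnv th)).
      rewrite (Sop_local _ _ thE) thE//; apply: le_trans.
      have s1k : `|s k| = 1 by apply: s1.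
      rewrite -[leRHS]mul1r -s1k -normrM mulrBr [s k * (s k * _)]mulrA.
      have -> : s k * s k = 1 by rewrite -expr2 -real_normK ?num_real// s1k expr1n.
      by rewrite mul1r.
    + move: y y1; apply: cube_convex => [|y y1].
        apply: (cvx R^o (fun y => g (Sop a K.+1 x' y) - a * y 0%N)) => b u v.
        by rewrite Sop_comb linearD linearZ/= -![_ *: _]/(_ * _); ring.
      have [th thE] := sgnv_surj y1.
      have := x2 (th, None); rewrite /phi /t /= -/(Sop a K.+1 x' (sgnv th)).
      by rewrite (Sop_local _ _ thE) thE.
  (* Halving [d] frees [(|g| - a) / 64 * d], which is exactly the bound on the new coordinate of
     [g]. *)
  rewrite big_ord_recr/=; lra.
move=> y y1 yK.
have extE : Sop a K.+1 x' y = Sop a K.+1 x' (ext y).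
  apply: Sop_local => i; rewrite ltnS leq_eqVlt => /predU1P[->|iK]; rewrite /ext ?ltnn//.
  by rewrite iK.
rewrite extE; move: y y1 {yK extE}; apply: cube_convex => [|y y1].
  apply: (cvx X (fun y => Sop a K.+1 x' (ext y) - Sop a K x y)) => b u v.
  have -> : ext (fun i => b * u i + v i) = fun i => b * ext u i + ext v i.
    by apply/funext => i; rewrite /ext; case: ifP => // _; ring.
  by rewrite !Sop_comb scalerBr opprD addrACA.
have [th thE] := sgnv_surj y1.
have := x1 (inr th); rewrite /= -/(Sop a K.+1 x' (ext (sgnv th))).
rewrite (Sop_local _ _ thE).
have -> : Sop a K.+1 x' (ext (sgnv th)) = Sop a K.+1 x' (ext y).
  by apply: Sop_local => i _; rewrite /ext (thE 0%N)//; case: ifP => // iK; rewrite thE.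
move=> /le_trans; apply.
have : 32 / (`|g| - a) * d * (1 + d / 2) <= 32 / (`|g| - a) * d * 2.
  rewrite ler_wpM2l//; last by lra.
  by rewrite mulr_ge0 ?divr_ge0 ?ltW.
lra.
Qed.

(** The new unit vector comes from [cluster_basis]. It approximates [g] on [F], which will give
    weak* convergence, and on the images of the sign vectors, as [stage_extend] demands. *)
Lemma stage_next K n s x d (F : seq X) : (0 < K)%N -> 0 < d -> d <= 2 ->
  stage K n s x d ->
  exists n' s' x', [/\ stage K.+1 n' s' x' (d / 2),
    forall k, (k < K)%N -> n' k = n k /\ s' k = s k,
    forall y, (forall i, (i < K)%N -> `|y i| <= 1) -> y K = a * y 0%N ->
      `|Sop a K.+1 x' y - Sop a K x y| <= 64 / (`|g| - a) * d &
    forall v, v \in F -> `|s' K * e (n' K) v - g v| <= d].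
Proof.
move=> K0 d0 d2 st; have [s1 n_inj _ _] := st.
have gam0 : 0 < `|g| - a by rewrite subr_gt0.
have tol : 0 < (`|g| - a) / 64 * d by rewrite mulr_gt0// divr_gt0.
have [N0 _ gN0] : \forall m \near \oo, `|co g m| <= (`|g| - a) / 64 * d.
  have /cvgr0_norm_le := coord_cvg0 He g; exact.
pose F' := F ++ [seq Sop a K x (sgnv th) | th <- enum {ffun 'I_K -> bool}].
(* Beyond [N0] the coordinates of [g] are small; being at least the sum of the [(n k).+1] puts [M]
   above every earlier index. *)
have [M [sM [NM sM1 eM]]] := cluster_basis He F' (maxn N0 (\sum_(k < K) (n k).+1)) g_cluster d0.
pose n' k := if k == K then M else n k.
pose s' k := if k == K then sM else s k.
have n'E k : (k < K)%N -> n' k = n k by move=> kK; rewrite /n' ltn_eqF.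
have s'E k : (k < K)%N -> s' k = s k by move=> kK; rewrite /s' ltn_eqF.
have nM k : (k < K)%N -> (n k < M)%N.
  move=> kK; apply: leq_trans (leq_trans (leq_maxr N0 _) NM).
  by rewrite (bigD1 (Ordinal kK))//= leq_addr.
have n'K : n' K = M by rewrite /n' eqxx.
have s'K : s' K = sM by rewrite /s' eqxx.
have n'_inj j k : (j <= K)%N -> (k <= K)%N -> n' j = n' k -> j = k.
  rewrite leq_eqVlt => /predU1P[->|jK]; rewrite leq_eqVlt => /predU1P[->|kK] //.
  - by rewrite n'K n'E// => Mk; have := nM _ kK; rewrite -Mk ltnn.
  - by rewrite n'K n'E// => Mk; have := nM _ jK; rewrite Mk ltnn.
  - by rewrite !n'E//; exact: n_inj.
have st' : stage K n' s' x d.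
  case: st => _ _ sty gs; split.
  - by move=> k kK; rewrite s'E ?s1.
  - by move=> j k jK kK; apply: n'_inj; exact: ltnW.
  - move=> y y1; have [h1 h2 h3] := sty y y1; split => // k kK.
    by rewrite s'E// n'E// h2.
  - by rewrite (eq_bigr (fun k : 'I_K => `|co g (n k)|)) => [//|k _]; rewrite n'E.
have [||||x' [stx xx]] := stage_extend K0 d0 d2 st'.
- by move=> k; rewrite leq_eqVlt => /predU1P[->|kK]; rewrite ?s'K ?s'E ?s1.
- exact: n'_inj.
- by rewrite n'K; apply: gN0; exact: leq_trans (leq_maxl _ _) NM.
- move=> y /sgnv_surj[th thE]; rewrite -(Sop_local _ _ thE) n'K s'K; apply: eM.
  by rewrite mem_cat; apply/orP; right; apply/mapP; exists th; rewrite ?mem_enum.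
exists n', s', x'; split => //; first by move=> k kK; rewrite n'E// s'E.
by move=> v vF; rewrite n'K s'K eM// mem_cat vF.
Qed.

(** The zero operator is within error 2. Half of the allowance [(|g| - a) / 8] goes to the term in
    [d = 2], the other half to a far coordinate of [g]. *)
Lemma stage_start : exists n s, stage 1 n s (fun=> 0) 2.
Proof.
have gam0 : 0 < `|g| - a by rewrite subr_gt0.
have tol : 0 < (`|g| - a) / 16 by rewrite divr_gt0.
have [N0 _ gN0] : \forall m \near \oo, `|co g m| <= (`|g| - a) / 16.
  have /cvgr0_norm_le := coord_cvg0 He g; exact.
exists (fun=> N0), (fun=> 1); split.
- by move=> k _; rewrite normr1.
- by move=> [|j] [|k].
- move=> y y1; have -> : Sop a 1 (fun=> 0) y = 0 :> X by rewrite /Sop big_ord1 scaler0.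
  split.
  + by rewrite normr0 addr_ge0.
  + by move=> [|k]// _; rewrite linear0 mulr0 sub0r normrN (le_trans (y1 _ _))// ler1n.
  + rewrite linear0 sub0r normrN normrM gtr0_norm//.
    have : a * `|y 0%N| <= a * 1 by rewrite ler_pM2l// y1.
    by have := ag; have := g1; lra.
- by rewrite big_ord1; have := gN0 N0 (leqnn _); lra.
Qed.

End step.

(** * Passage to the limit *)

Section limit.
Context {R : realType} {X : completeNormedModType R} (e : nat -> dual X)
  (co : dual X -> nat -> R).
Hypothesis He : ell1_basis e co.
Variables (g : dual X) (a : R).
Hypotheses (a0 : 0 < a) (ag : a < `|g|) (g1 : `|g| <= 1).
Hypothesis g_cluster :
  weak_star_limit_points (extreme_points (unit_ball (dual X))) g.

Let tol K : R := 2 / 2 ^+ K.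

Let tol0 K : 0 < tol K. Proof. by rewrite divr_gt0// exprn_gt0. Qed.

Let tolS K : tol K.+1 = tol K / 2. Proof. by rewrite /tol exprSr invfM mulrA. Qed.

Let tol2 K : tol K <= 2.
Proof. by rewrite /tol ler_piMr// invf_le1 ?exprn_gt0// exprn_ege1// ler1n. Qed.

Let tol_cvg0 : tol @ \oo --> 0.
Proof.
rewrite -[X in _ --> X](mulr0 2); apply: cvgMl_tmp.
have -> : (fun K => (2 ^+ K)^-1 : R) = (fun K => 2^-1 ^+ K) by apply/funext => K; rewrite exprVn.
by apply: cvg_expr; rewrite ger0_norm ?invr_ge0// invf_lt1// ltr1n.
Qed.

Lemma stage_eq K n s n' s' (x : nat -> X) d :
  (forall k, (k < K)%N -> n' k = n k /\ s' k = s k) ->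
  stage e co g a K n s x d -> stage e co g a K n' s' x d.
Proof.
move=> E [s1 ni sty gs]; split.
- by move=> k kK; rewrite (E _ kK).2 s1.
- by move=> j k jK kK; rewrite (E _ jK).1 (E _ kK).1; exact: ni.
- move=> y y1; have [h1 h2 h3] := sty y y1; split => // k kK.
  by rewrite (E _ kK).1 (E _ kK).2 h2.
- by rewrite (eq_bigr (fun k : 'I_K => `|co g (n k)|)) => [//|k _]; rewrite (E _ (ltn_ord k)).1.
Qed.

(** Dependent choice iterates [stage_next]. As the construction starts on [F_1], index [K] carries
    the operator on [F_(K+1)]. *)
Lemma stages_exist (F : nat -> X) : exists n s (x : nat -> nat -> X),
  [/\ forall K, stage e co g a K.+1 n s (x K) (tol K),
    forall K y, (forall i, (i <= K)%N -> `|y i| <= 1) -> y K.+1 = a * y 0%N ->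
      `|Sop a K.+2 (x K.+1) y - Sop a K.+1 (x K) y| <= 64 / (`|g| - a) * tol K &
    forall K j, (j <= K)%N -> `|s K.+1 * e (n K.+1) (F j) - g (F j)| <= tol K].
Proof.
pose St := ((nat -> nat) * (nat -> R) * (nat -> X))%type.
pose P (p : nat * St) := stage e co g a p.1.+1 p.2.1.1 p.2.1.2 p.2.2 (tol p.1).
pose T := {p : nat * St | P p}.
pose rel (p q : nat * St) := [/\ q.1 = p.1.+1,
    forall k, (k <= p.1)%N -> q.2.1.1 k = p.2.1.1 k /\ q.2.1.2 k = p.2.1.2 k,
    forall y, (forall i, (i <= p.1)%N -> `|y i| <= 1) -> y p.1.+1 = a * y 0%N ->
      `|Sop a p.1.+2 q.2.2 y - Sop a p.1.+1 p.2.2 y| <= 64 / (`|g| - a) * tol p.1 &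
    forall j, (j <= p.1)%N ->
      `|q.2.1.2 p.1.+1 * e (q.2.1.1 p.1.+1) (F j) - g (F j)| <= tol p.1].
have next (p : T) : {q : T | rel (sval p) (sval q)}.
  apply: cid; case: p => -[K [[n s] x]] Pp; have st := Pp; rewrite /P/= in st.
  have [n' [s' [x' [st' E xx eF]]]] :=
    stage_next He a0 ag g1 g_cluster [seq F j | j <- iota 0 K.+1] (ltn0Sn K) (tol0 K) (tol2 K) st.
  rewrite -tolS in st'.
  exists (exist P (K.+1, (n', s', x')) st'); split => //= j jK; apply: eF.
  by apply: map_f; rewrite mem_iota.
have [n0 [s0 st0]] := stage_start He a0 ag g1.
have {}st0 : P (0%N, (n0, s0, fun=> 0)) by rewrite /P/= /tol expr0 divr1.
have [f [f0 fR]] := @dependent_choice T (fun p q => rel (sval p) (sval q)) next (exist P _ st0).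
pose n K := (sval (f K)).2.1.1; pose s K := (sval (f K)).2.1.2; pose x K := (sval (f K)).2.2.
have f1 K : (sval (f K)).1 = K.
  by elim: K => [|K IH]; [rewrite f0|have [-> _ _ _] := fR K; rewrite IH].
(* Entry [k] is fixed from index [k] on, so the diagonal sequences agree with all later choices. *)
have E K k : (k <= K)%N -> n k k = n K k /\ s k k = s K k.
  elim: K => [|K IH]; first by rewrite leqn0 => /eqP ->.
  rewrite leq_eqVlt => /predU1P[->//|]; rewrite ltnS => kK.
  have [_ h _ _] := fR K; rewrite f1 in h.
  by have [-> ->] := IH kK; have [h1 h2] := h k kK; rewrite /n /s h1 h2.
exists (fun k => n k k), (fun k => s k k), x; split.
- move=> K; apply: (@stage_eq _ (n K) (s K)); first by move=> k kK; exact: E.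
  by have := svalP (f K); rewrite /P f1.
- by move=> K y; have [_ _ h _] := fR K; move: h; rewrite f1; exact.
- by move=> K j jK; have [_ _ _ h] := fR K; move: h; rewrite f1; apply.
Qed.

Lemma stage_scale K n s (x : nat -> X) d y b : stage e co g a K n s x d -> 0 < b ->
  (forall i, (i < K)%N -> `|y i| <= b) ->
  [/\ `|Sop a K x y| <= (1 + d) * b,
      forall k, (k < K)%N -> `|s k * e (n k) (Sop a K x y) - y k| <= d * b &
      `|g (Sop a K x y) - a * y 0%N| <= d * b].
Proof.
move=> [_ _ st _] b0 yb; pose z i := b^-1 * y i.
have yE : y = fun i => b * z i + 0 by apply/funext => i; rewrite /z addr0 mulVKf// gt_eqF.
have yk k : y k = b * z k by rewrite /z mulVKf// gt_eqF.
have [|h1 h2 h3] := st z.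
  by move=> i iK; rewrite /z normrM gtr0_norm ?invr_gt0// ler_pdivrMl// mulr1 yb.
have S0 : Sop a K x (fun=> 0) = 0 :> X.
  have := Sop_comb a K x 1 (fun=> 0) (fun=> 0); rewrite mulr0 addr0 scale1r => /eqP.
  by rewrite eq_sym -subr_eq0 addrK => /eqP.
have SE : Sop a K x y = b *: Sop a K x z by rewrite yE Sop_comb S0 addr0.
have fE (f : dual X) : f (Sop a K x y) = b * f (Sop a K x z) by rewrite SE linearZ.
split.
- by rewrite SE normrZ gtr0_norm// mulrC ler_pM2r.
- move=> k kK; rewrite fE yk mulrCA -mulrBr normrM gtr0_norm// mulrC ler_pM2r//.
  exact: h2.
- by rewrite fE yk mulrCA -mulrBr normrM gtr0_norm// mulrC ler_pM2r.
Qed.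

(** The vectors where convergence holds form a subspace, closed because all norms are at most 1. A
    vector outside it would yield, by Hahn-Banach, a nonzero functional vanishing on every [F j]. *)
Lemma dense_cvg (phi : nat -> dual X) (F : nat -> X) :
  (forall f : dual X, (forall j, f (F j) = 0) -> f = 0) ->
  (forall k, `|phi k| <= 1) ->
  (forall j, (fun k => phi k (F j)) @ \oo --> g (F j)) ->
  forall v, (fun k => phi k v) @ \oo --> g v.
Proof.
move=> Ftot phi1 phiF v; pose D := [set v | (fun k => phi k v) @ \oo --> g v].
have [//|/= nDv] := pselect (D v).
have [r r0 rD] : exists2 r, 0 < r & forall w, D w -> r <= `|v - w|.
  apply: contrapT => nr; apply: nDv; apply/cvgrPdist_le => eps eps0.
  have e3 : 0 < eps / 3 by rewrite divr_gt0.
  have /existsNP[w /not_implyP[Dw /negP]] : ~ forall w, D w -> eps / 3 <= `|v - w|.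
    by move=> h; apply: nr; exists (eps / 3).
  rewrite -ltNge => vw; have /cvgrPdist_le/(_ _ e3) := Dw; apply: filterS => k.
  have fb (f : dual X) : `|f| <= 1 -> `|f v - f w| <= eps / 3.
    move=> f1; rewrite -linearB (le_trans (dual_le _ _))//.
    by rewrite (le_trans _ (ltW vw))// ler_piMl.
  have := fb _ g1; have := fb _ (phi1 k); rewrite !ler_norml; lra.
have [||||f [fl f1 f0 fv]] := @hahn_banach_dist R X (fun x => `|x|) D v r.
- by split=> [x y|c x]; [exact: ler_normD|rewrite normrZ].
- rewrite /D/= linear0; under eq_fun do rewrite linear0; exact: cvg_cst.
- move=> c x y Dx Dy; rewrite /D/= linearD linearZ.
  under eq_fun do rewrite linearD linearZ; apply: cvgD => //.
  exact: cvgMl_tmp.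
- exact: rD.
have [f' f'E] : exists f' : dual X, forall x, f' x = f x.
  by apply: (@exists_dual _ _ f 1) => // x; rewrite mul1r.
have := f'E v; rewrite (Ftot f') => [fv0|j]; last by rewrite f'E f0//; exact: phiF.
by have : f v = 0; [rewrite -fv0|move: fv; lra].
Qed.

(** [S] is the pointwise limit of the operators of [stages_exist]. Their errors are multiples of
    [tol K], so the approximate requirements become equalities. *)
Lemma embedding_exists : exists (phi : nat -> dual X) (S : (nat -> R) -> X),
  [/\ forall k, `|phi k| <= 1,
      forall v, (fun k => phi k v) @ \oo --> g v,
      forall c y z, y @ \oo --> a * y 0%N -> z @ \oo --> a * z 0%N ->
        S (fun i => c * y i + z i) = c *: S y + S z,
      forall y b, y @ \oo --> a * y 0%N -> (forall i, `|y i| <= b) -> `|S y| <= b &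
      forall y, y @ \oo --> a * y 0%N ->
        (forall k, phi k (S y) = y k) /\ g (S y) = a * y 0%N].
Proof.
have [F Ftot] := total_sequence He.
have [n [s [x [st xx eF]]]] := stages_exist F.
pose phi k := s k *: e (n k).
have s1 k : `|s k| = 1 by case: (st k) => h _ _ _; exact: h.
have phiE k v : phi k v = s k * e (n k) v by [].
have phi1 k : `|phi k| <= 1 by rewrite normrZ s1 mul1r (basis_norm He).
have gam0 : 0 < `|g| - a by rewrite subr_gt0.
pose SK K y : X := Sop a K.+1 (x K) y.
pose W y := y @ \oo --> a * y 0%N.
pose bnd (y : nat -> R) b := 0 < b /\ forall i, `|y i| <= b.
have Wbnd y : W y -> exists b, bnd y b.
  move=> Wy; have /pinfty_ex_gt0[b b0 yb] : bounded_fun y.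
    by apply: cvg_seq_bounded; apply/cvg_ex; eexists; exact: Wy.
  by exists b; split => // i; exact: yb.
pose C := 64 / (`|g| - a).
have C0 : 0 < C by rewrite divr_gt0.
have a1 : a <= 1 by rewrite (le_trans (ltW ag)).
have SKcvg y : W y -> cvgn (fun K => SK K y).
  move=> Wy; have [b [b0 yb]] := Wbnd _ Wy.
  apply: cauchy_cvg; apply: cauchy_exP => eps eps0.
  have e6 : 0 < eps / 8 by rewrite divr_gt0.
  have tb : (fun K => 2 * C * tol K * b) @ \oo --> 0.
    rewrite -[X in _ --> X](mul0r b); apply: cvgMr_tmp.
    by rewrite -[X in _ --> X](mulr0 (2 * C)); exact: cvgMl_tmp.
  have [K _ KP] : \forall K \near \oo,
      `|y K - a * y 0%N| <= eps / 8 /\ 2 * C * tol K * b <= eps / 2.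
    have /cvgrPdist_le/(_ _ e6) n1 := Wy.
    have e2 : 0 < eps / 2 by rewrite divr_gt0.
    have /cvgr0_norm_le/(_ _ e2) n2 := tb.
    apply: filterS2 n1 n2.
    by move=> K; rewrite distrC => h1 h2; split => //; exact: le_trans (ler_norm _) h2.
  exists (SK K y); exists K => // J /= KJ; rewrite -ball_normE /ball_/=.
  (* The operators from index [K] on are compared on [tr], the truncation of [y] to [F_(K+1)]; the
     rest [y - tr] is at most [eps / 8]. *)
  pose tr i := if (i <= K)%N then y i else a * y 0%N.
  have tr0 : tr 0%N = y 0%N by [].
  have trb i : `|tr i| <= b.
    rewrite /tr; case: ifP => // _; rewrite normrM gtr0_norm//.
    by rewrite (le_trans _ (yb 0%N))// ler_piMl.
  have step i : (K <= i)%N -> `|SK i.+1 tr - SK i tr| <= C * tol i * b.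
    move=> Ki; pose z j := b^-1 * tr j.
    have := xx i z; rewrite -/C => h.
    have {h} : `|SK i.+1 z - SK i z| <= C * tol i.
      apply: h => [j _|]; last first.
        by rewrite /z /tr leqNgt ltnS Ki/= mulrCA.
      by rewrite /z normrM gtr0_norm ?invr_gt0// ler_pdivrMl// mulr1.
    have trE : tr = fun i => b * z i + 0 by apply/funext => j; rewrite /z addr0 mulVKf// gt_eqF.
    have E M : SK M tr = b *: SK M z.
      rewrite trE /SK Sop_comb; have -> : Sop a M.+1 (x M) (fun=> 0) = 0; last by rewrite addr0.
      have := Sop_comb a M.+1 (x M) 1 (fun=> 0) (fun=> 0); rewrite mulr0 addr0 scale1r => /eqP.
      by rewrite eq_sym -subr_eq0 addrK => /eqP.
    by move=> h; rewrite !E -scalerBr normrZ gtr0_norm// [leLHS]mulrC ler_pM2r.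
  (* Each tolerance telescopes: [tol i = 2 * (tol i - tol i.+1)]. *)
  have tele : `|SK J tr - SK K tr| <= 2 * C * (tol K - tol J) * b.
    rewrite -(subnKC KJ); elim: (J - K)%N => [|m IH].
      by rewrite addn0 !subrr normr0 mulr0 mul0r.
    have := step _ (leq_addr m K).
    have := ler_distD (SK (K + m)%N tr) (SK (K + m).+1 tr) (SK K tr).
    by move: IH; rewrite addnS tolS; lra.
  (* The factor 3 bounds [1 + tol J]. With [eps / 2] from the telescoping sum the total stays below
     [eps]. *)
  have rem : `|SK J (fun i => -1 * tr i + y i)| <= 3 * (eps / 8).
    have [|h _ _] := @stage_scale _ _ _ _ _ (fun i => -1 * tr i + y i) _ (st J) e6.
      move=> i _; rewrite mulN1r addrC /tr; case: ifPn => [_|]; first by rewrite subrr normr0 ltW.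
      by rewrite -ltnNge => Ki; have [] := KP i (ltnW Ki).
    by apply: le_trans h _; rewrite ler_wpM2r ?(ltW e6)//; have := tol2 J; lra.
  have trK : SK K tr = SK K y by apply: Sop_local => i iK; rewrite /tr -ltnS iK.
  have trJ : SK J y = SK J tr + SK J (fun i => -1 * tr i + y i).
    by rewrite /SK Sop_comb scaleN1r addNKr.
  rewrite trJ opprD addrA -trK (le_lt_trans (ler_normB _ _))// distrC.
  have [_ hK] := KP K (leqnn _).
  have : 0 <= 2 * C * tol J * b.
    apply: mulr_ge0; last exact: ltW b0.
    apply: mulr_ge0; last exact: ltW (tol0 J).
    by rewrite mulr_ge0// ltW.
  by move: tele rem hK; lra.
pose S y := limn (fun K => SK K y).
have Slim y : W y -> (fun K => SK K y) @ \oo --> S y by move=> /SKcvg.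
have feval (f : dual X) y : W y -> (fun K => f (SK K y)) @ \oo --> f (S y).
  by move=> /Slim h; apply: continuous_cvg h; exact: dual_continuous.
have feq (f : dual X) y t b k0 : W y ->
    (forall K, (k0 <= K)%N -> `|f (SK K y) - t| <= tol K * b) -> f (S y) = t.
  move=> Wy ft; apply: (cvg_unique (@Rhausdorff R) (feval f y Wy)).
  apply/subr_cvg0; apply: norm_cvg0.
  have tb : (fun K => tol K * b) @ \oo --> 0.
    by rewrite -[X in _ --> X](mul0r b); exact: cvgMr_tmp.
  apply: (@squeeze_cvgr _ _ _ _ (cst 0) _ _ _ _ (cvg_cst _) tb).
  by exists k0 => // K /= kK; rewrite normr_ge0 ft.
exists phi, S; split => //.
- apply: dense_cvg Ftot phi1 _ => j; rewrite -(cvg_shiftn 1); apply/cvgrPdist_le => eps eps0.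
  have [K _ KP] := cvgr0_norm_le _ tol_cvg0 _ eps0.
  exists (maxn K j) => // i /=; rewrite geq_max => /andP[Ki ji]; 
  rewrite addn1 -[X in `|X|]/(g (F j) - s i.+1 * e (n i.+1) (F j)) distrC.
  by rewrite (le_trans (eF _ _ ji))// (le_trans (ler_norm _))// KP.
- move=> c y z Wy Wz; apply: (cvg_lim (@norm_hausdorff _ _)).
  have -> : (fun K => SK K (fun i => c * y i + z i)) = (fun K => c *: SK K y + SK K z).
    by apply/funext => K; rewrite /SK Sop_comb.
  by apply: cvgD; [apply: cvgZl_tmp; exact: Slim|exact: Slim].
- move=> y b Wy yb; apply/ler_addgt0Pr => t t0.
  (* [b] may be 0, whereas [stage_scale] requires a positive bound. *)
  have bt : 0 < b + t by rewrite ltr_wpDl// (le_trans _ (yb 0%N)).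
  have tb : (fun K => (1 + tol K) * (b + t)) @ \oo --> b + t.
    rewrite -[X in _ --> X]mul1r; apply: cvgMr_tmp.
    by rewrite -[X in _ --> X]addr0; apply: cvgD; [exact: cvg_cst|].
  apply: (ler_cvg_to (cvg_norm (Slim _ Wy)) tb); apply: nearW => K.
  have [|h _ _] := stage_scale (y := y) (st K) bt; last exact: h.
  by move=> i _; rewrite (le_trans (yb i))// lerDl ltW.
- move=> y Wy; have [b [b0 yb]] := Wbnd _ Wy; split=> [k|].
    apply: (feq _ _ _ b k Wy) => K kK; rewrite phiE.
    by have [|_ h _] := stage_scale (y := y) (st K) b0; [move=> i _; exact: yb|apply: h].
  apply: (feq _ _ _ b 0%N Wy) => K _.
  by have [|_ _ h] := stage_scale (y := y) (st K) b0; [move=> i _; exact: yb|exact: h].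
Qed.

End limit.

(** * The complemented copy of [W_alpha] *)

Lemma W_spaceP {R : realType} (b : R) (w : cseq R) :
  W_space (ell1_head b) w <-> (w : nat -> R) @ \oo --> b * w 0%N.
Proof.
have E : limn (series (fun i => ell1_head b i * w i)) = b * w 0%N.
  apply: (cvg_lim (@Rhausdorff R)); rewrite -(cvg_shiftn 1); apply: cvg_near_cst.
  near=> N; rewrite /= addn1 -[LHS]/(\sum_(0 <= i < N.+1) (if i == 0%N then b else 0) * w i).
  by rewrite big_nat_recl//= big1 ?addr0// => i _; rewrite mul0r.
rewrite /W_space/= E; split=> [<-|]; first exact: cseq_cvg.
exact: cvg_lim.
Unshelve. all: by end_near. Qed.

Theorem theorem7p1 (R : realType) (X : completeNormedModType R)
  (hX : isometric_onto [set: dual X] [set: ell1 R])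
  (eps : R) (heps : 0 < eps < r_star X) :
  exists Y : set X,
    [/\ closed_subspace Y,
        isometric_onto Y (W_space (ell1_head (r_star X / (1 + eps)))) &
        complemented (1 + eps) Y].
Proof.
have /andP[eps0 epsr] := heps.
have e1 : 0 < 1 + eps by rewrite addr_gt0.
have r0 : 0 < r_star X by exact: lt_trans epsr.
set a := r_star X / (1 + eps).
have a0 : 0 < a by rewrite divr_gt0.
have ar : a * (1 + eps) = r_star X by rewrite divfK// gt_eqF.
have a_lt_r : a < r_star X by rewrite -ar ltr_pMr// ltrDl.
have [e [co He]] := ell1_basis_exists hX.
pose L := weak_star_limit_points (extreme_points (unit_ball (dual X))).
(* Without a supremum, [sup] would take its default value 0, against [r_star X > 0]. *)
have hs : has_sup [set `|g| | g in L].
  by apply: contrapT => /sup_out h; move: r0; rewrite /r_star h ltxx.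
have [_ [g Lg <-] ag] : exists2 t, [set `|g| | g in L] t & a < t.
  by apply: sup_gt; [case: hs|exact: a_lt_r].
have gr : `|g| <= a * (1 + eps).
  by rewrite ar; apply: (sup_upper_bound hs); exists g.
have g1 := cluster_norm_le1 He Lg.
have [phi [S [phi1 phig Sl Sle SP]]] := embedding_exists He a0 ag g1 Lg.
(* Coordinate 0 is [g x / a] and not [phi 0 x], so that the limit [g x] is [a] times it; the price
   is the factor [|g| / a <= 1 + eps]. *)
pose T x k : R := if k == 0%N then g x / a else phi k x.
have Tcvg x : T x @ \oo --> a * T x 0%N.
  rewrite {2}/T/= mulrC divfK ?gt_eqF// -(cvg_shiftn 1).
  rewrite (_ : (fun k => T x (k + 1)%N) = fun k => phi (k + 1)%N x).
    by rewrite (cvg_shiftn 1 (fun k => phi k x : R)); exact: phig.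
  by apply/funext => k; rewrite addn1.
have Tl (c : R) x y : T (c *: x + y) = fun k => c * T x k + T y k.
  apply/funext => k; rewrite /T; case: ifP => _; rewrite linearD linearZ//=.
  by rewrite mulrDl -mulrA.
have Tle x k : `|T x k| <= (1 + eps) * `|x|.
  rewrite /T; case: ifP => _.
    rewrite normrM normfV (gtr0_norm a0) ler_pdivrMr// (le_trans (dual_le _ _))//.
    by rewrite mulrAC ler_wpM2r// mulrC.
  rewrite (le_trans (dual_le _ _))// ler_wpM2r// (le_trans (phi1 _))// lerDl ltW//.
have TS y : y @ \oo --> a * y 0%N -> T (S y) = y.
  move=> Wy; have [Sphi Sg] := SP y Wy; apply/funext => k; rewrite /T.
  by case: eqP => [->|_]; rewrite ?Sg ?Sphi// mulrC mulKf// gt_eqF.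
pose P x := S (T x).
have Pl : linear P by move=> c x y; rewrite /P Tl; exact: Sl.
pose P' : {linear X -> X} := HB.pack P (GRing.isLinear.Build R X X *:%R P Pl).
have Ple x : `|P x| <= (1 + eps) * `|x| by apply: Sle.
have PP x : P (P x) = P x by rewrite /P TS.
have cP : continuous P by exact: (@bounded_linear_continuous _ _ _ P' (1 + eps)).
have YE y : range P y <-> P y = y by split=> [[x _ <-]|<-]; [exact: PP|exists y].
have cT x : (T x : nat -> R^o) \in @cseq_pred R.
  by apply/cseq_predP; apply/cvg_ex; eexists; exact: Tcvg.
pose T' x : cseq R := CSeq (cT x).
(* On the range of [P] coordinate 0 equals [phi 0 x] as well, since [phi k (S y) = y k] for all [k].
   There the factor [1 + eps] improves to 1, which makes [T'] isometric. *)
have phiP x k : P x = x -> phi k x = T x k.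
  by move=> <-; rewrite (SP _ (Tcvg x)).1 /P TS.
have T'0 x k : `|T x k| <= `|T' x|.
  by rewrite cseq_normE; apply: (sup_upper_bound (cseq_has_sup (T' x))); exists k.
exists (range P); split.
- split.
  + rewrite (_ : range P = (fun x => P x - x) @^-1` [set 0]); last first.
      apply/seteqP; split=> [x /YE Px|x /= /eqP]; first by rewrite /= Px subrr.
      by rewrite subr_eq0 => /eqP Px; apply/YE.
    apply: preimage_closed => [x _|].
      by apply: continuousB; [exact: cP|exact: cvg_id].
    by apply: accessible_closed_set1; apply: hausdorff_accessible; exact: norm_hausdorff.
  + by apply/YE; exact: (linear0 P').
  + by move=> c x y /YE Px /YE Py; apply/YE; rewrite Pl Px Py.
- exists T'; split.
  + by move=> c x y _ _; apply/val_inj; rewrite /= Tl.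
  + move=> x /YE Px; apply/eqP; rewrite eq_le; apply/andP; split.
      rewrite cseq_normE; apply: ge_sup; first by case: (cseq_has_sup (T' x)).
      move=> _ [k _ <-]; rewrite -[X in `|X|]/(T x k) -phiP//.
      by rewrite (le_trans (dual_le _ _))// ler_piMl.
    by rewrite -{1}Px; apply: Sle => // k; exact: T'0.
  + apply/seteqP; split=> [_ [x _ <-]|w /W_spaceP Ww]; first exact/W_spaceP/Tcvg.
    exists (S w); first by apply/YE; rewrite /P TS.
    by apply/val_inj; exact: TS.
- exists P'; split => //; first by move=> y /YE.
  by apply: op_norm_le => x x1; rewrite (le_trans (Ple x))// ler_piMr// ltW//.
Qed.
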